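(* In the strict Gaussian-texture limit model defined in the context, the observed finite-dimensional distributions satisfy $$P^Y_{0,\lambda}=P^Y_{0,-\lambda}\qquad(\lambda\in\mathbb R).$$ In particular, whenever the observed density $p^Y_{0,\lambda}$ is differentiable in $\lambda$, $$\partial_\lambda\log p^Y_{0,\lambda}\big|_{\lambda=0}=0\qquad P^Y_{0,0}\text{-a.s.},$$ and the Fisher metric written in the signed coordinate $\lambda$ loses rank at the fixed point $\lambda=0$.
   Context: Strict Gaussian-texture limit model: fix $A>0$, $B_0>0$, $\Delta t>0$. Let $Z$ be the stationary Gaussian Ornstein–Uhlenbeck process $dZ_t=-AZ_t\,dt+\sqrt{2A}\,dW^x_t$, $Z_t\sim N(0,1)$. For $\lambda\in\mathbb R$ put $B_\lambda(z)=B_0\exp(\lambda z-\lambda^2/2)$. The two quadratures of $\gamma=\gamma^R+i\gamma^I$ satisfy $$d\gamma^{R}_t=-\frac{B_\lambda(Z_t)}2\gamma^R_t\,dt+\sqrt{\frac{B_\lambda(Z_t)}2}\,dW^R_t,\qquad d\gamma^{I}_t=-\frac{B_\lambda(Z_t)}2\gamma^I_t\,dt+\sqrt{\frac{B_\lambda(Z_t)}2}\,dW^I_t,$$ with independent Brownian motions $W^x,W^R,W^I$ and stationary initial condition $\gamma^R_0,\gamma^I_0$ i.i.d. $N(0,1/2)$, independent of $Z$. The observation is $Y_k=(\operatorname{Re}\gamma_{k\Delta t},\operatorname{Im}\gamma_{k\Delta t})^\top$, $k\ge0$ ($Z$ is latent). $P^Y_{0,\lambda}$ denotes any finite-dimensional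 law of $(Y_k)$ under parameter $\lambda$ and $p^Y_{0,\lambda}$ its density; $B_0$ may be an additional parameter (coordinate $\beta=\log B_0$). *)

(* Defs.v *)
From HB Require Import structures.
From mathcomp Require Import all_boot all_order all_algebra.
From mathcomp Require Import all_classical all_reals all_analysis.

Set Implicit Arguments.
Unset Strict Implicit.
Unset Printing Implicit Defensive.

Import Order.TTheory GRing.Theory Num.Theory.
Import numFieldNormedType.Exports.

Local Open Scope classical_set_scope.
Local Open Scope ring_scope.

Section lebesgue_tuple.
Variable R : realType.

Section cons.
Variables (n : nat) (mu : {measure set (n.-tuple (R * R)) -> \bar R}).

Definition pair_cons (x : (n.-tuple (R * R) * R) * R) : n.+1.-tuple (R * R) :=
  [tuple of (x.1.2, x.2) :: x.1.1].

Lemma measurable_pair_cons :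
  measurable_fun [set: (n.-tuple (R * R) * R) * R] pair_cons.
Proof.
apply: (@measurable_cons _ _ _ _ (fun x => (x.1.2, x.2)) _ (fun x => x.1.1)).
  apply/measurable_fun_pair => //.
  exact: (measurableT_comp measurable_snd measurable_fst).
exact: (measurableT_comp measurable_fst measurable_fst).
Qed.

Definition cons_measure (A : set (n.+1.-tuple (R * R))) : \bar R :=
  ((mu \x lebesgue_measure) \x lebesgue_measure)%E (pair_cons @^-1` A).

Let measurable_pre (A : set (n.+1.-tuple (R * R))) :
  measurable A -> measurable (pair_cons @^-1` A).
Proof.
by move=> mA; rewrite -[X in measurable X]setTI; exact: measurable_pair_cons.
Qed.

Let cons_measure0 : cons_measure set0 = 0%E.
Proof. by rewrite /cons_measure preimage_set0 measure0. Qed.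

Let cons_measure_ge0 A : (0 <= cons_measure A)%E.
Proof. exact: measure_ge0. Qed.

Let cons_measure_sigma_additive : semi_sigma_additive cons_measure.
Proof.
move=> F mF tF mUF; rewrite /cons_measure preimage_bigcup.
apply: measure_semi_sigma_additive.
- by move=> i; exact: measurable_pre.
- apply/trivIsetP => /= i j _ _ ij; rewrite -preimage_setI.
  by move/trivIsetP : tF => /(_ _ _ _ _ ij) ->//; rewrite preimage_set0.
- by rewrite -preimage_bigcup; exact: measurable_pre.
Qed.

HB.instance Definition _ := isMeasure.Build _ _ _ cons_measure
  cons_measure0 cons_measure_ge0 cons_measure_sigma_additive.

End cons.

(* Lebesgue measure on (R * R)^n. *)
Fixpoint lebesgue_tuple (n : nat) : {measure set (n.-tuple (R * R)) -> \bar R} :=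
  match n with
  | 0%N => dirac ([tuple] : 0.-tuple (R * R))
  | m.+1 => cons_measure (lebesgue_tuple m)
  end.

End lebesgue_tuple.

Section stochastic_calculus.
Context d (Omega : measurableType d) (R : realType) (P : probability Omega R).

Definition cvg_in_probability (X : nat -> Omega -> R) (Y : Omega -> R) : Prop :=
  [/\ forall n, measurable_fun setT (X n), measurable_fun setT Y &
      forall e : R, 0 < e ->
        P [set w | e <= `|X n w - Y w|] @[n --> \oo] --> 0%E].

(* Time runs over the nonnegative reals; values at negative times play no role
   anywhere below. *)
Definition filtration (F : R -> set (set Omega)) : Prop :=
  [/\ forall t, 0 <= t -> sigma_algebra setT (F t),
      forall t, 0 <= t -> F t `<=` measurable &
      forall s t, 0 <= s -> s <= t -> F s `<=` F t].

Definition measurable_wrt (G : set (set Omega)) (X : Omega -> R) : Prop :=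
  forall B : set R, measurable B -> G (X @^-1` B).

Definition continuous_adapted (F : R -> set (set Omega)) (X : R -> Omega -> R) :
    Prop :=
  (forall t, 0 <= t -> measurable_wrt (F t) (X t)) /\
  (forall w, {within `[0, +oo[, continuous (fun t => X t w)}).

(* X1, X2, X3 are independent centred Gaussians with standard deviations
   s1, s2, s3, and (X1, X2, X3) is independent of the sigma-algebra G. *)
Definition indep_centred_gaussians (G : set (set Omega)) (X1 X2 X3 : Omega -> R)
    (s1 s2 s3 : R) : Prop :=
  forall C (B1 B2 B3 : set R),
    G C -> measurable B1 -> measurable B2 -> measurable B3 ->
    P (C `&` (X1 @^-1` B1 `&` X2 @^-1` B2 `&` X3 @^-1` B3)) =
    (P C * (normal_prob 0 s1 B1 * normal_prob 0 s2 B2 * normal_prob 0 s3 B3))%E.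

(* (W1, W2, W3) is a standard three-dimensional F-Brownian motion; in
   particular W1, W2, W3 are independent, and independent of F 0. *)
Record brownian_motion3 (F : R -> set (set Omega)) (W1 W2 W3 : R -> Omega -> R) :
    Prop := {
  bm_adapted1 : continuous_adapted F W1 ;
  bm_adapted2 : continuous_adapted F W2 ;
  bm_adapted3 : continuous_adapted F W3 ;
  bm_start : {ae P, forall w, [/\ W1 0 w = 0, W2 0 w = 0 & W3 0 w = 0]} ;
  bm_increments : forall s t, 0 <= s -> s < t ->
    indep_centred_gaussians (F s)
      (fun w => W1 t w - W1 s w) (fun w => W2 t w - W2 s w)
      (fun w => W3 t w - W3 s w)
      (Num.sqrt (t - s)) (Num.sqrt (t - s)) (Num.sqrt (t - s)) }.

(* The step process sum_(i < n) xi_i 1_]t_i, t_i.+1], where xi_i is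
   F_(t_i)-measurable. *)
Record step_process := StepProcess {
  sp_size : nat ;
  sp_time : nat -> R ;
  sp_coef : nat -> Omega -> R }.

Definition step_adapted (F : R -> set (set Omega)) (S : step_process) : Prop :=
  [/\ 0 <= sp_time S 0,
      {homo sp_time S : i j / (i <= j)%N >-> i <= j} &
      forall i, (i < sp_size S)%N ->
        measurable_wrt (F (sp_time S i)) (sp_coef S i)].

Definition step_value (S : step_process) (s : R) (w : Omega) : R :=
  \sum_(i < sp_size S)
    sp_coef S i w * \1_(`]sp_time S i, sp_time S i.+1]%classic) s.

Definition step_integral (S : step_process) (W : R -> Omega -> R) (T : R)
    (w : Omega) : R :=
  \sum_(i < sp_size S) sp_coef S i w *
    (W (Num.min (sp_time S i.+1) T) w - W (Num.min (sp_time S i) T) w).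

(* X is (a version of) the Ito integral of the adapted process H against the
   F-Brownian motion W over [0, T]: the limit in probability of the integrals
   of adapted step processes converging to H in L^2([0, T]) in probability. *)
Definition is_ito_integral (F : R -> set (set Omega)) (W H : R -> Omega -> R)
    (T : R) (X : Omega -> R) : Prop :=
  exists S : nat -> step_process,
    [/\ forall n, step_adapted F (S n),
        cvg_in_probability
          (fun n w => \int[lebesgue_measure]_(s in `[0, T])
                        (step_value (S n) s w - H s w) ^+ 2)
          (cst 0) &
        cvg_in_probability (fun n => step_integral (S n) W T) X].

(* dX_t = b_t dt + sigma_t dW_t *)
Definition solves_sde (F : R -> set (set Omega)) (W X b sigma : R -> Omega -> R) :
    Prop :=
  forall t, 0 <= t -> exists M : Omega -> R,
    is_ito_integral F W sigma t M /\
    {ae P, forall w,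
      X t w = X 0 w + \int[lebesgue_measure]_(s in `[0, t]) b s w + M w}.

End stochastic_calculus.

Definition texture_rate (R : realType) (B0 lambda z : R) : R :=
  B0 * expR (lambda * z - lambda ^+ 2 / 2).

(* The filtration, being arbitrary, allows any weak solution. The initial triple
   is F 0-measurable, hence independent of the Brownian motions; as Z is driven
   by Z 0 and Wx only, tm_initial makes (gR 0, gI 0) independent of the whole
   process Z. *)
Record texture_model (R : realType) (A B0 lambda : R)
    d (Omega : measurableType d) (P : probability Omega R)
    (F : R -> set (set Omega)) (Wx WR WI Z gR gI : R -> Omega -> R) : Prop := {
  tm_filtration : filtration F ;
  tm_brownian : brownian_motion3 P F Wx WR WI ;
  tm_adaptedZ : continuous_adapted F Z ;
  tm_adaptedR : continuous_adapted F gR ;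
  tm_adaptedI : continuous_adapted F gI ;
  tm_initial : indep_centred_gaussians P [set setT] (Z 0) (gR 0) (gI 0)
    1 (Num.sqrt 2^-1) (Num.sqrt 2^-1) ;
  tm_sdeZ : solves_sde P F Wx Z
    (fun t w => - A * Z t w) (fun _ _ => Num.sqrt (2 * A)) ;
  tm_sdeR : solves_sde P F WR gR
    (fun t w => - (texture_rate B0 lambda (Z t w) / 2) * gR t w)
    (fun t w => Num.sqrt (texture_rate B0 lambda (Z t w) / 2)) ;
  tm_sdeI : solves_sde P F WI gI
    (fun t w => - (texture_rate B0 lambda (Z t w) / 2) * gI t w)
    (fun t w => Num.sqrt (texture_rate B0 lambda (Z t w) / 2)) }.

(* Q is the law of (Y_(k_0), ..., Y_(k_(n-1))). *)
Definition is_observed_law (R : realType) (A B0 Dt lambda : R) (n : nat)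
    (k : 'I_n -> nat) (Q : probability (n.-tuple (R * R)) R) : Prop :=
  exists d (Omega : measurableType d) (P : probability Omega R)
    (F : R -> set (set Omega)) (Wx WR WI Z gR gI : R -> Omega -> R),
    texture_model A B0 lambda P F Wx WR WI Z gR gI /\
    forall U : set (n.-tuple (R * R)), measurable U ->
      Q U = P [set w | U [tuple (gR ((k i)%:R * Dt) w, gI ((k i)%:R * Dt) w)
                          | i < n]].

Definition is_density d (T : measurableType d) (R : realType)
    (mu : {measure set T -> \bar R}) (Q : probability T R) (f : T -> R) : Prop :=
  [/\ measurable_fun setT f, forall y, 0 <= f y &
      forall U, measurable U -> Q U = (\int[mu]_(y in U) (f y)%:E)%E].

(* Entries E_Q[d_i log p_theta d_j log p_theta], to be used with Q the law of
   density p theta. *)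
Definition fisher_mx d (T : measurableType d) (R : realType) (m : nat)
    (Q : probability T R) (p : 'rV[R]_m -> T -> R) (theta : 'rV[R]_m) : 'M[R]_m :=
  \matrix_(i < m, j < m)
    \int[Q]_y ('D_(delta_mx 0 i) (fun th => ln (p th y)) theta *
               'D_(delta_mx 0 j) (fun th => ln (p th y)) theta).

(* Main.v *)
Require Import Defs.
From mathcomp Require Import all_boot all_order all_algebra.
From mathcomp Require Import all_classical all_reals all_analysis.
From mathcomp Require Import measurable_realfun.
From mathcomp Require Import ring lra.

(** The rate of the quadratures depends on [lambda] and on the texture [Z] through
    [lambda * Z] and [lambda ^+ 2] only.  Hence [(- Z, - Wx)] turns a solution with
    parameter [lambda] into a solution with parameter [- lambda] and the same
    quadratures ([texture_model_opp]).  The equality of the observed laws is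
    therefore the uniqueness in law of the model: two weak solutions with the same
    parameters, on two unrelated probability spaces, have the same observed law
    ([observed_law_unique]).

    Uniqueness in law is obtained by exhibiting the observations as one and the
    same measurable functional of the driving noise, that is, of the initial values
    and the Brownian paths, on both spaces.  The laws of the two noises agree, since
    on every dyadic grid they are products of Gaussian laws ([same_noise_law]).
    Being the same functional of the noise on both spaces ([coded]) is preserved by
    measurable operations, by almost sure limits and, along a subsequence, by
    limits in probability ([coded_probability_lim]).  The three equations of the
    model are linear in their own unknown, with a nonnegative damping rate; the
    solution of such an equation is a limit of explicit functionals in two stages
    ([coded_linear_sde]):
    - its Ito integral is the limit in probability of left-point sums
      ([ito_integral_left_sums]).  As the integral is only given through some
      approximating step processes, these have to be compared with the left-point
      steps, on a common refinement of the partitions, by a tail bound for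
      martingale transforms ([martingale_transform_tail]);
    - once the Ito integral is known, the equation is an ordinary linear equation
      on each path, solved by the Euler scheme ([euler_cvg]).
    This applies first to the texture, and then to the quadratures, whose
    coefficients are continuous functions of the texture.

    As for the score, the densities at [lambda] and [- lambda] agree almost
    everywhere, for all [lambda = 1 / n.+1] simultaneously.  Where [p] is
    differentiable in [lambda] at [0], this forces its derivative to vanish
    ([derive_even_along_seq]), and so does the derivative of [ln p] because the
    density is almost surely positive.  The entries of the Fisher metric that
    involve the coordinate [lambda] are then integrals of almost surely null
    functions, which gives the metric a zero row ([fisher_mx_rank_lt]). *)

Set Implicit Arguments.
Unset Strict Implicit.
Unset Printing Implicit Defensive.

Import Order.TTheory GRing.Theory Num.Theory.
Import numFieldNormedType.Exports.

Local Open Scope classical_set_scope.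
Local Open Scope ring_scope.

(** * Centred Gaussian laws *)

Section gaussian.
Variable R : realType.
Local Notation mu := (@lebesgue_measure R).

Lemma normal_prob_opp (s : R) (A : set R) : s != 0 -> measurable A ->
  normal_prob 0 s (-%R @^-1` A) = normal_prob 0 s A.
Proof.
move=> s0 mA; rewrite /normal_prob.
have mo : measurable_fun [set: measurableTypeR R]
    (-%R : measurableTypeR R -> measurableTypeR R) by [].
have pdfN x : normal_pdf 0 s (- x) = normal_pdf 0 s x.
  by rewrite /normal_pdf (negbTE s0) /normal_fun !subr0 sqrrN.
transitivity (\int[mu]_(x in -%R @^-1` A) (normal_pdf 0 s (- x))%:E)%E.
  by apply: eq_integral => x _; rewrite pdfN.
rewrite -(@ge0_integral_pushforward _ _ _ _ R _ mo mu A
  (fun x => (normal_pdf 0 s x)%:E))//.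
- by apply: eq_measure_integral => B mB _; exact: lebesgue_measureN.
- by apply/measurable_EFinP/measurable_funTS; exact: measurable_normal_pdf.
- by move=> x _; rewrite lee_fin normal_pdf_ge0.
Qed.

Lemma ge0_integral_normal_prob (s : R) (f : R -> \bar R) : s != 0 ->
  measurable_fun setT f -> (forall x, 0 <= f x)%E ->
  (\int[normal_prob 0 s]_y f y = \int[mu]_y (f y * (normal_pdf 0 s y)%:E))%E.
Proof.
move=> s0 mf f0.
have dom := normal_prob_dominates 0 s.
rewrite -(Radon_Nikodym_SigmaFinite.change_of_variables dom)//.
have mpdf : measurable_fun setT (fun y => (normal_pdf 0 s y)%:E).
  by apply/measurable_EFinP; exact: measurable_normal_pdf.
have mrn := measurable_int _ (Radon_Nikodym_SigmaFinite.f_integrable dom).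
apply: ae_eq_integral => //; [exact: emeasurable_funM..|].
have : ae_eq mu setT (Radon_Nikodym_SigmaFinite.f (normal_prob 0 s) mu)
    (fun y => (normal_pdf 0 s y)%:E).
  apply: integral_ae_eq => //.
    exact: Radon_Nikodym_SigmaFinite.f_integrable.
  by move=> E _ mE; rewrite -Radon_Nikodym_SigmaFinite.f_integral.
by apply: filterS => x /= + _ => ->.
Qed.

(** The inequality [u <= exp u] compares [y ^+ 2] times one Gaussian density
    with a Gaussian density of twice the variance.  Only the order of magnitude
    in [s] is used later, whence the crude constant. *)
Lemma normal_second_moment (s : R) : s != 0 ->
  (\int[normal_prob 0%R s]_y (y ^+ 2)%:E <= (8 * s ^+ 2)%:E)%E.
Proof.
move=> s0.
have r0 : Num.sqrt 2 * s != 0 :> R.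
  by rewrite mulf_neq0// sqrtr_eq0 -ltNge.
rewrite ge0_integral_normal_prob//; last 2 first.
- by apply/measurable_EFinP; exact: measurable_funX.
- by move=> y; rewrite lee_fin sqr_ge0.
apply: (@le_trans _ _ (\int[mu]_y ((4 * s ^+ 2 * Num.sqrt 2)%:E *
    (normal_pdf 0 (Num.sqrt 2 * s) y)%:E)))%E.
  apply: ge0_le_integral => //.
  - by move=> y _; rewrite -EFinM lee_fin mulr_ge0 ?sqr_ge0// normal_pdf_ge0.
  - apply/measurable_EFinP/measurable_funM; first exact: measurable_funX.
    exact: measurable_normal_pdf.
  - apply/measurable_EFinP/measurable_funM; first exact: measurable_cst.
    exact: measurable_normal_pdf.
  move=> y _; rewrite -!EFinM lee_fin /normal_pdf (negbTE s0) (negbTE r0).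
  have -> : normal_peak (Num.sqrt 2 * s) = (Num.sqrt 2)^-1 * normal_peak s.
    rewrite /normal_peak exprMn sqr_sqrtr// -!mulrnAr -!mulrA sqrtrM// invfM//.
  rewrite /normal_fun !subr0 exprMn sqr_sqrtr//.
  set u := y ^+ 2 / (4 * s ^+ 2).
  have s2 : s ^+ 2 != 0 by rewrite expf_neq0.
  have s2p : 0 < s ^+ 2 by rewrite exprn_even_gt0.
  have yu : y ^+ 2 = 4 * s ^+ 2 * u by rewrite /u mulrC divfK// mulf_neq0.
  have -> : - y ^+ 2 / (s ^+ 2 *+ 2) = - u + - u.
    by rewrite yu; field.
  have -> : - y ^+ 2 / (2 * s ^+ 2 *+ 2) = - u.
    by rewrite yu; field.
  rewrite expRD yu.
  have uu : u * expR (- u) <= 1.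
    rewrite expRN ler_pdivrMr ?expR_gt0// mul1r.
    by apply: le_trans (expR_ge1Dx u); rewrite lerDr.
  have q : Num.sqrt 2 * (Num.sqrt 2)^-1 = 1 :> R.
    by rewrite divff// sqrtr_eq0 -ltNge.
  rewrite [leLHS](_ : _ = (4 * s ^+ 2 * normal_peak s * expR (- u)) *
     (u * expR (- u))); last by ring.
  rewrite [leRHS](_ : _ = (4 * s ^+ 2 * normal_peak s * expR (- u)) *
     (Num.sqrt 2 * (Num.sqrt 2)^-1)); last by ring.
  by rewrite q ler_wpM2l// mulr_ge0 ?expR_ge0// mulr_ge0 ?normal_peak_ge0// mulr_ge0// ltW.
rewrite ge0_integralZl//.
(* the constant [8] absorbs [4 * Num.sqrt 2] *)
- rewrite integral_normal_pdf mule1 lee_fin.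
  have : Num.sqrt 2 <= 2 :> R.
    have := @sqr_sqrtr R 2 (ler0n _ _); have := sqrtr_ge0 (2 : R); nra.
  have := sqr_ge0 s; nra.
- by apply/measurable_EFinP; exact: measurable_normal_pdf.
- by move=> y _; rewrite lee_fin normal_pdf_ge0.
- by rewrite lee_fin mulr_ge0 ?sqrtr_ge0// mulr_ge0// sqr_ge0.
Qed.

(** The symmetry of the Gaussian law cancels the cross term. *)
Lemma normal_affine_second_moment (s a c : R) : s != 0 ->
  (\int[normal_prob 0%R s]_y ((a + c * y) ^+ 2)%:E <=
   (a ^+ 2 + c ^+ 2 * (8 * s ^+ 2))%:E)%E.
Proof.
move=> s0.
have mf (b : R) : measurable_fun setT (fun y : R => ((a + b * y) ^+ 2)%:E).
  apply/measurable_EFinP; apply: measurable_funX; apply: measurable_funD => //.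
have sym : (\int[normal_prob 0 s]_y ((a + c * y) ^+ 2)%:E =
    \int[normal_prob 0 s]_y ((a + (- c) * y) ^+ 2)%:E)%E.
  have mo : measurable_fun [set: measurableTypeR R]
    (-%R : measurableTypeR R -> measurableTypeR R) by [].
  symmetry; transitivity (\int[normal_prob 0 s]_(y in -%R @^-1` setT)
      ((fun y : R => ((a + c * y) ^+ 2)%:E) \o -%R) y)%E.
    by apply: eq_integral => y _ /=; rewrite mulNr mulrN.
  rewrite -(@ge0_integral_pushforward _ _ _ _ R _ mo)//.
    apply: eq_measure_integral => B mB _; exact: normal_prob_opp.
    exact: mf.
  by move=> y _; rewrite lee_fin sqr_ge0.
suff : (\int[normal_prob 0 s]_y ((a + c * y) ^+ 2)%:E +
   \int[normal_prob 0 s]_y ((a + c * y) ^+ 2)%:E <=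
   (a ^+ 2 + c ^+ 2 * (8 * s ^+ 2))%:E + (a ^+ 2 + c ^+ 2 * (8 * s ^+ 2))%:E)%E.
  set I := (\int[_]_y _)%E.
  have : (0 <= I)%E by apply: integral_ge0 => y _; rewrite lee_fin sqr_ge0.
  by case: I => //= r _; rewrite -!EFinD !lee_fin; lra.
rewrite {2}sym -ge0_integralD//; last 4 first.
- by move=> y _; rewrite lee_fin sqr_ge0.
- exact: mf.
- by move=> y _; rewrite lee_fin sqr_ge0.
- exact: mf.
rewrite [leLHS](_ : _ = (\int[normal_prob 0 s]_y
    ((2 * a ^+ 2)%:E + (2 * c ^+ 2)%:E * (y ^+ 2)%:E))%E); last first.
  by apply: eq_integral => y _; rewrite -EFinM -!EFinD; congr EFin; ring.
rewrite ge0_integralD//; first last.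
- by apply/measurable_EFinP/measurable_funM => //; exact: measurable_funX.
- by move=> y _; rewrite -EFinM lee_fin mulr_ge0 ?sqr_ge0// mulr_ge0 ?sqr_ge0.
- by move=> y _; rewrite lee_fin mulr_ge0 ?sqr_ge0.
rewrite integral_cst// [X in (_ * X + _)%E](_ : _ = 1%E); last first.
  exact: probability_setT.
rewrite mule1 ge0_integralZl//; first last.
- by rewrite lee_fin mulr_ge0 ?sqr_ge0.
- by move=> y _; rewrite lee_fin sqr_ge0.
- by apply/measurable_EFinP; exact: measurable_funX.
apply: (@le_trans _ _ ((2 * a ^+ 2)%:E + (2 * c ^+ 2)%:E * (8 * s ^+ 2)%:E)%E).
  rewrite leeD2l// lee_wpmul2l//; last exact: normal_second_moment.
  by rewrite lee_fin mulr_ge0 ?sqr_ge0.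
by rewrite -EFinM -!EFinD lee_fin; lra.
Qed.
End gaussian.

(** * Integrating out an independent Gaussian variable *)

Section sub_sigma_algebra.
Context d (Omega : measurableType d) (R : realType) (P : probability Omega R).
Variable G : set (set Omega).
Hypotheses (sG : sigma_algebra setT G) (Gm : G `<=` measurable).
Local Notation OG := (g_sigma_algebraType G).

(** Measurability with respect to [G] is measurability on the space that carries
    [G] as its only events, where the usual closure properties apply. *)
Lemma measurable_wrtP (X : Omega -> R) :
  measurable_wrt G X <-> measurable_fun [set: OG] (X : OG -> R).
Proof.
have GE := measurable_g_measurableTypeE sG; split => mX.
  by move=> _ B mB; rewrite setTI GE; exact: mX.
by move=> B mB; have := mX measurableT B mB; rewrite setTI GE.
Qed.

Lemma measurable_fun_sub d' (T : measurableType d') (X : Omega -> T) :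
  measurable_fun [set: OG] (X : OG -> T) -> measurable_fun [set: Omega] X.
Proof.
have GE := measurable_g_measurableTypeE sG.
by move=> mX _ B mB; have := mX measurableT B mB; rewrite GE => /Gm.
Qed.

Lemma measurable_id_sub : measurable_fun [set: Omega] (id : Omega -> OG).
Proof. exact: measurable_fun_sub. Qed.

Variables (xi : Omega -> R) (s : R).
Hypotheses (s0 : s != 0) (mxi : measurable_fun setT xi).
Hypothesis indep : forall C B, G C -> measurable B ->
  P (C `&` xi @^-1` B) = (P C * normal_prob 0 s B)%E.

(** Given [G], the variable [a + c * xi] is Gaussian with mean [a] and standard
    deviation [`|c| * s]: under [P] the pair made of the identity, valued in
    [(Omega, G)], and of [xi] has a product law, so Tonelli's theorem
    integrates [xi] out with [a] and [c] frozen. *)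
Lemma second_moment_affine_indep (a c : Omega -> R) :
    measurable_wrt G a -> measurable_wrt G c ->
  (\int[P]_w ((a w + c w * xi w) ^+ 2)%:E <=
   \int[P]_w (a w ^+ 2 + c w ^+ 2 * (8 * s ^+ 2))%:E)%E.
Proof.
move=> /measurable_wrtP ma /measurable_wrtP mc.
have GE := measurable_g_measurableTypeE sG.
pose Y : {mfun Omega >-> OG} := mfun_Sub (mem_set measurable_id_sub).
have mpair : measurable_fun [set: Omega] ((fun w => (w, xi w)) : Omega -> OG * measurableTypeR R).
  apply: measurable_fun_pair => //; exact: measurable_id_sub.
pose Z : {mfun Omega >-> (OG * measurableTypeR R)%type} := mfun_Sub (mem_set mpair).
have mphi : measurable_fun [set: OG * measurableTypeR R]
    (fun z : OG * measurableTypeR R => ((a z.1 + c z.1 * z.2) ^+ 2)%:E).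
  apply/measurable_EFinP; apply: measurable_funX; apply: measurable_funD.
    exact: (measurableT_comp ma measurable_fst).
  apply: measurable_funM => //.
  exact: (measurableT_comp mc measurable_fst).
have phi0 z : (0 <= ((a z.1 + c z.1 * z.2) ^+ 2)%:E :> \bar R)%E.
  by rewrite lee_fin sqr_ge0.
rewrite [leLHS](_ : _ = \int[distribution P Z]_z
    ((a z.1 + c z.1 * z.2) ^+ 2)%:E)%E; last first.
  by rewrite ge0_integral_distribution.
rewrite [leLHS](_ : _ = \int[distribution P Y \x normal_prob 0 s]_z
    ((a z.1 + c z.1 * z.2) ^+ 2)%:E)%E; last first.
  apply: eq_measure_integral => B mB _; symmetry.
  apply: product_measure_unique => //.
  by move=> A C mA mC; have := mA; rewrite {1}GE => GA; rewrite -indep.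
rewrite fubini_tonelli1//.
rewrite [leRHS](_ : _ = \int[distribution P Y]_w
    (a w ^+ 2 + c w ^+ 2 * (8 * s ^+ 2))%:E)%E; last first.
  rewrite ge0_integral_distribution//.
    apply/measurable_EFinP; apply: measurable_funD; first exact: measurable_funX.
    by apply: measurable_funM => //; exact: measurable_funX.
  by move=> w; rewrite lee_fin addr_ge0 ?sqr_ge0// mulr_ge0 ?sqr_ge0//
    mulr_ge0 ?sqr_ge0.
apply: ge0_le_integral => //.
- by move=> w _; apply: integral_ge0.
- exact: measurable_fun_fubini_tonelli_F.
- apply/measurable_EFinP; apply: measurable_funD; first exact: measurable_funX.
  by apply: measurable_funM => //; exact: measurable_funX.
- by move=> w _; exact: (normal_affine_second_moment (a w) (c w) s0).
Qed.

End sub_sigma_algebra.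

(** * A tail bound for martingale transforms *)

Section martingale_transform.
Context d (Omega : measurableType d) (R : realType) (P : probability Omega R).
Variables (L : nat) (G : nat -> set (set Omega)) (c xi : nat -> Omega -> R)
  (s : nat -> R).
Hypotheses (sG : forall l, (l <= L)%N -> sigma_algebra setT (G l))
  (Gm : forall l, (l <= L)%N -> G l `<=` measurable)
  (Gle : forall j l, (j <= l)%N -> (l <= L)%N -> G j `<=` G l)
  (mc : forall l, (l < L)%N -> measurable_wrt (G l) (c l))
  (mxi : forall l, (l < L)%N -> measurable_wrt (G l.+1) (xi l))
  (s0 : forall l, (l < L)%N -> s l != 0)
  (indep : forall l, (l < L)%N -> forall C B, G l C -> measurable B ->
     P (C `&` xi l @^-1` B) = (P C * normal_prob 0 (s l) B)%E).

Let I l w := \sum_(j < l) c j w * xi j w.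
Let V l w := \sum_(j < l) (c j w) ^+ 2 * (s j) ^+ 2.

Let measurable_wrt_le j l (X : Omega -> R) : (j <= l)%N -> (l <= L)%N ->
  measurable_wrt (G j) X -> measurable_wrt (G l) X.
Proof. by move=> jl lL mX B mB; exact: Gle (mX _ mB). Qed.

Let mG l (lL : (l <= L)%N) (X : Omega -> R) := measurable_wrtP (sG lL) X.

Let mI l : (l <= L)%N -> measurable_wrt (G l) (I l).
Proof.
move=> lL; apply/mG => //; apply: measurable_sum => j.
have jL : (j < L)%N by exact: leq_trans lL.
apply: measurable_funM; apply/mG => //.
  by apply: measurable_wrt_le (mc jL) => //; exact: ltnW.
exact: measurable_wrt_le (mxi jL).
Qed.

Let mV l : (l < L)%N -> measurable_wrt (G l) (V l.+1).
Proof.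
move=> lL; apply/mG => //; first exact: ltnW.
apply: measurable_sum => j; apply: measurable_funM => //; apply: measurable_funX.
have jL : (j < L)%N by apply: leq_ltn_trans lL; rewrite -ltnS.
apply/mG; first exact: ltnW.
by apply: measurable_wrt_le (mc jL); [rewrite -ltnS|exact: ltnW].
Qed.

Let mV' l : (l <= L)%N -> measurable_wrt (G l) (V l).
Proof.
move=> lL; apply/mG => //.
apply: measurable_sum => j; apply: measurable_funM => //; apply: measurable_funX.
have jL : (j < L)%N by apply: leq_trans lL.
by apply/mG => //; apply: measurable_wrt_le (mc jL) => //; exact: ltnW.
Qed.

Variables (delta e : R).
Hypotheses (delta0 : 0 <= delta) (e0 : 0 < e).

Let on l w : R := \1_(`]-oo, delta]%classic) (V l w).
Let Phi l w := on l w * (I l w ^+ 2 + 8 * (delta - V l w)).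

Let onE l w : on l w = (V l w <= delta)%R%:R.
Proof. by rewrite /on indicE mem_setE in_itv. Qed.

Let Phi_ge0 l w : 0 <= Phi l w.
Proof.
rewrite /Phi onE; case: (leP (V l w)) => Vd; last by rewrite mulr0n mul0r.
by rewrite mulr1n mul1r addr_ge0 ?sqr_ge0// mulr_ge0// subr_ge0.
Qed.

Let m_on d' (T : measurableType d') (f : T -> R) : measurable_fun setT f ->
  measurable_fun setT (fun w => \1_(`]-oo, delta]%classic) (f w) : R).
Proof. by move=> mf; apply: measurableT_comp mf; exact: measurable_indic. Qed.

Let mPhi l : (l <= L)%N -> measurable_fun setT (Phi l).
Proof.
move=> lL; have /mG mIl := mI lL; have /mG mVl := mV' lL.
apply: (measurable_fun_sub (sG lL) (Gm lL)); apply: measurable_funM.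
  by apply: m_on; exact: mVl.
apply: measurable_funD; first by apply: measurable_funX; exact: mIl.
by apply: measurable_funM => //; apply: measurable_funB => //; exact: mVl.
Qed.

Let supermartingale l : (l < L)%N ->
  (\int[P]_w (Phi l.+1 w)%:E <= \int[P]_w (Phi l w)%:E)%E.
Proof.
move=> lL; have lL' := ltnW lL.
pose a w := on l.+1 w * I l w; pose c' w := on l.+1 w * c l w.
pose r w := on l.+1 w * (8 * (delta - V l.+1 w)).
have IS w : I l.+1 w = I l w + c l w * xi l w by rewrite /I big_ord_recr.
have VS w : V l.+1 w = V l w + c l w ^+ 2 * s l ^+ 2 by rewrite /V big_ord_recr.
have on2 w : on l.+1 w ^+ 2 = on l.+1 w.
  by rewrite /on indicE; case: (_ \in _); rewrite ?expr1n ?expr0n.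
have r0 w : 0 <= r w.
  rewrite /r onE; case: (leP (V l.+1 w)) => Vd; last by rewrite mulr0n mul0r.
  by rewrite mulr1n mul1r mulr_ge0// subr_ge0.
have /(mG lL') mIl := mI lL'; have /(mG lL') mVl := mV lL.
have /(mG lL') mcl := mc lL; have mon := m_on mVl.
have ma : measurable_wrt (G l) a by apply/mG => //; exact: measurable_funM.
have mc' : measurable_wrt (G l) c' by apply/mG => //; exact: measurable_funM.
have mr : measurable_wrt (G l) r.
  apply/mG => //; apply: measurable_funM => //; apply: measurable_funM => //.
  exact: measurable_funB.
have toP (X : Omega -> R) : measurable_wrt (G l) X -> measurable_fun setT (X : Omega -> R).
  by move=> /(mG lL') h; exact: (measurable_fun_sub (sG lL') (Gm lL') h).
have mxil : measurable_fun setT (xi l).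
  apply: (measurable_fun_sub (sG lL) (Gm lL)); apply/mG => //; exact: mxi.
rewrite [leLHS](_ : _ = \int[P]_w (((a w + c' w * xi l w) ^+ 2)%:E + (r w)%:E))%E;
    last first.
  apply: eq_integral => w _; rewrite -EFinD; congr EFin.
  rewrite /Phi IS /a /c' /r mulrDr -{1}on2; ring.
rewrite ge0_integralD//; first last.
- exact/measurable_EFinP/toP.
- by move=> w _; rewrite lee_fin.
- apply/measurable_EFinP/measurable_funX/measurable_funD; first exact: toP.
  by apply: measurable_funM => //; exact: toP.
- by move=> w _; rewrite lee_fin sqr_ge0.
have step := second_moment_affine_indep (sG lL') (Gm lL') (s0 lL) mxil
  (indep lL) ma mc'.
apply: (le_trans (leeD2r _ step)).
have q0 w : 0 <= a w ^+ 2 + c' w ^+ 2 * (8 * s l ^+ 2).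
  by rewrite addr_ge0 ?sqr_ge0// mulr_ge0 ?sqr_ge0// mulr_ge0 ?sqr_ge0.
have mq : measurable_fun setT (fun w => a w ^+ 2 + c' w ^+ 2 * (8 * s l ^+ 2)).
  apply: measurable_funD; first by apply: measurable_funX; exact: toP.
  by apply: measurable_funM => //; apply: measurable_funX; exact: toP.
rewrite -ge0_integralD//; first last.
- exact/measurable_EFinP/toP.
- by move=> w _; rewrite lee_fin.
- exact/measurable_EFinP.
- by move=> w _; rewrite lee_fin.
apply: ge0_le_integral => //.
- by move=> w _; rewrite -EFinD lee_fin addr_ge0.
- by apply/measurable_EFinP; apply: measurable_funD => //; exact: toP.
- by apply/measurable_EFinP/mPhi.
move=> w _; rewrite -EFinD lee_fin.
have -> : a w ^+ 2 + c' w ^+ 2 * (8 * s l ^+ 2) + r w =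
    on l.+1 w * (I l w ^+ 2 + 8 * (delta - V l w)).
  by rewrite /a /c' /r VS !exprMn on2; ring.
rewrite {1}onE; case: (leP (V l.+1 w)) => Vd; last first.
  by rewrite mulr0n mul0r; exact: Phi_ge0.
have Vl : V l w <= delta.
  by apply: le_trans Vd; rewrite VS lerDl mulr_ge0 ?sqr_ge0.
by rewrite /Phi onE Vl.
Qed.

(** Doob's trick of stopping before the quadratic variation [V] exceeds
    [delta], in closed form: [8 * (delta - V)] pays for the growth of [I ^+ 2],
    so [Phi := (I ^+ 2 + 8 * (delta - V)) * (V <= delta)] is a nonnegative
    supermartingale started at [8 * delta], to which Markov's inequality
    applies. *)
Lemma martingale_transform_tail :
  (P [set w | (e <= `|\sum_(j < L) c j w * xi j w|)%R] <=
   P [set w | (delta < \sum_(j < L) c j w ^+ 2 * s j ^+ 2)%R] +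
   (8 * delta / e ^+ 2)%:E)%E.
Proof.
have PhiL l : (l <= L)%N -> (\int[P]_w (Phi l w)%:E <= (8 * delta)%:E)%E.
  elim: l => [_|l IH lL]; last first.
    by apply: le_trans (IH (ltnW lL)); exact: supermartingale.
  rewrite (eq_integral (cst (8 * delta)%:E)).
    rewrite integral_cst// [X in (_ * X)%E](_ : _ = 1%E) ?mule1//.
    exact: probability_setT.
  move=> w _; rewrite /Phi onE /V /I !big_ord0 delta0.
  by rewrite mulr1n mul1r expr0n add0r subr0.
have e2 : 0 < e ^+ 2 by rewrite exprn_gt0.
have mIL : measurable_fun setT (I L).
  by apply: (measurable_fun_sub (sG (leqnn L)) (Gm (leqnn L))); apply/mG => //; exact: mI.
have mVL : measurable_fun setT (V L).
  by apply: (measurable_fun_sub (sG (leqnn L)) (Gm (leqnn L))); apply/mG => //; exact: mV'.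
have mPhiL : measurable_fun setT (EFin \o Phi L) by apply/measurable_EFinP/mPhi.
have markov := @le_integral_abse _ _ _ P setT measurableT _ _ mPhiL e2.
rewrite setTI in markov.
pose A := [set w | ((e ^+ 2)%:E <= `|(Phi L w)%:E|)%E].
have mA : measurable A.
  by rewrite -[A]setTI; apply: emeasurable_fun_c_infty => //; exact: measurableT_comp.
pose B := [set w | delta < V L w].
have mB : measurable B.
  rewrite (_ : B = V L @^-1` `]delta, +oo[); last first.
    by apply/seteqP; split => w /=; rewrite in_itv/= andbT.
  by rewrite -[_ @^-1` _]setTI; exact: mVL.
have PA : (P A <= (8 * delta / e ^+ 2)%:E)%E.
  rewrite EFinM lee_pdivlMr//.
  rewrite muleC; apply: le_trans markov _.
  apply: le_trans (PhiL _ (leqnn L)); rewrite le_eqVlt; apply/orP; left.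
  by apply/eqP/eq_integral => w _ /=; rewrite ger0_norm.
apply: (@le_trans _ _ (P (B `|` A))).
  apply: le_measure; rewrite ?inE.
  - rewrite -[X in measurable X]setTI.
    rewrite (_ : [set w | _] = [set w | (e%:E <= `|(I L w)%:E|)%E])//.
    by apply: emeasurable_fun_c_infty => //; apply/measurableT_comp/measurable_EFinP.
  - exact: measurableU.
  move=> w /= eI; case: (leP (V L w) delta) => Vd; [right|by left].
  rewrite /A /= lee_fin ger0_norm// /Phi onE Vd mulr1n mul1r.
  rewrite (@le_trans _ _ (I L w ^+ 2))// ?lerDl ?mulr_ge0 ?subr_ge0//.
  by rewrite -[leRHS]real_normK ?num_real// lerXn2r// nnegrE ltW.
apply: (le_trans (measureU2 _ _ _)) => //.
exact: leeD2l.
Qed.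

End martingale_transform.

(** * Step processes on a common partition *)

Section partition.
Variable R : realType.
Implicit Types (u : seq R) (x T : R).

Lemma ord_pred_ltn n (l : 'I_n.-1) : (l.+1 < n)%N.
Proof. by case: n l => [[]|n l] //=; rewrite ltnS. Qed.

Lemma sum_increments_upto (f : nat -> R) p L :
  \sum_(l < L) (l < p)%N%:R * (f l.+1 - f l) = f (minn p L) - f 0.
Proof.
elim: L => [|L IH]; first by rewrite big_ord0 minn0 subrr.
rewrite big_ord_recr/= IH; have [Lp|pL] := ltnP L p.
  by rewrite (minn_idPr Lp) mul1r; ring.
by rewrite (minn_idPl (leqW pL)) mul0r addr0.
Qed.

Lemma sorted_gap u x l : sorted <%R u -> x \in u -> (l.+1 < size u)%N ->
  (x < u`_l.+1) = (x <= u`_l).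
Proof.
move=> su /(nthP 0)[p pu <-] lu.
rewrite (lt_sorted_ltn_nth 0 su) ?inE// (lt_sorted_leq_nth 0 su) ?inE//.
exact: ltnW.
Qed.

Lemma telescope_partition u x (f : R -> R) : sorted <%R u -> x \in u ->
  f x - f u`_0 =
  \sum_(l < (size u).-1) (u`_l.+1 <= x)%R%:R * (f u`_l.+1 - f u`_l).
Proof.
move=> su /(nthP 0)[p pu <-].
transitivity (\sum_(l < (size u).-1) (l < p)%N%:R * (f u`_l.+1 - f u`_l)).
  have pu' : (p <= (size u).-1)%N by rewrite -ltnS prednK// (leq_ltn_trans _ pu).
  by rewrite (sum_increments_upto (fun l => f u`_l)) (minn_idPl pu').
apply: eq_bigr => l _; congr (_%:R * _).
by rewrite (lt_sorted_leq_nth 0 su) ?inE// ord_pred_ltn.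
Qed.

Lemma indic_itv_min (a b x T : R) : a <= b -> x <= T ->
  \1_(`]a, b]%classic) x =
  (x <= Num.min b T)%R%:R - (x <= Num.min a T)%R%:R :> R.
Proof.
move=> ab xT; rewrite indicE mem_setE in_itv/= !le_min xT !andbT.
case: (leP x a) => xa /=.
  by rewrite (le_trans xa ab) subrr.
by rewrite subr0.
Qed.

Lemma integral_partition u (f : R -> R) l : sorted <%R u -> (l < size u)%N ->
    (forall x, 0 <= f x) -> measurable_fun setT f ->
    (forall j x, (j < l)%N -> u`_j < x -> x <= u`_j.+1 -> f x = f u`_j.+1) ->
  (\int[lebesgue_measure]_(x in `[u`_0, u`_l]) (f x)%:E)%E =
  (\sum_(j < l) f u`_j.+1 * (u`_j.+1 - u`_j))%:E.
Proof.
move=> su + f0 mf; elim: l => [lu fE|l IH lu fE].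
  by rewrite big_ord0 set_itv1 integral_set1.
have u0l : u`_0 <= u`_l by rewrite (lt_sorted_leq_nth 0 su) ?inE// (leq_ltn_trans _ lu).
have ull : u`_l < u`_l.+1 by rewrite (lt_sorted_ltn_nth 0 su) ?inE// ltnW.
have -> : `[u`_0, u`_l.+1]%classic = `[u`_0, u`_l] `|` `]u`_l, u`_l.+1] :> set R.
  by rewrite -itv_bndbnd_setU// bnd_simp// ltW.
rewrite ge0_integral_setU//=; last 3 first.
- by apply/measurable_EFinP; exact: measurable_funTS.
- by move=> x _; rewrite lee_fin.
- apply/disj_setPS => x /= []; rewrite !in_itv/= => /andP[_ xl] /andP[lx _].
  by move: (lt_le_trans lx xl); rewrite ltxx.
rewrite IH ?(ltnW lu)//; last by move=> j x jl; apply: fE; exact: ltnW.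
rewrite big_ord_recr/= EFinD; congr (_ + _)%E.
rewrite (eq_integral (cst (f u`_l.+1)%:E)); last first.
  move=> x; rewrite inE/= in_itv/= => /andP[lx xl]; congr EFin.
  exact: fE.
by rewrite integral_cst//= lebesgue_measure_itv/= lte_fin ull -EFinD -EFinM.
Qed.

End partition.

Section step_processes.
Context d (Omega : measurableType d) (R : realType) (P : probability Omega R).

(** What one component of a three-dimensional Brownian motion retains of it,
    the continuity of paths aside. *)
Definition gaussian_increments (F : R -> set (set Omega)) (W : R -> Omega -> R) :=
  (forall t, 0 <= t -> measurable_wrt (F t) (W t)) /\
  (forall s t, 0 <= s -> s < t -> forall C B, F s C -> measurable B ->
     P (C `&` (fun w => W t w - W s w) @^-1` B) =
     (P C * normal_prob 0%R (Num.sqrt (t - s)) B)%E).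

Variables (F : R -> set (set Omega)) (W : R -> Omega -> R).
Hypotheses (hF : filtration F) (hW : gaussian_increments F W).
Implicit Type S : step_process Omega R.

Lemma step_time_ge0 S i : step_adapted F S -> 0 <= sp_time S i.
Proof. by case=> t0 tm _; apply: le_trans t0 _; exact: tm. Qed.

Definition refines T (u : seq R) S :=
  forall i, (i <= sp_size S)%N -> Num.min (sp_time S i) T \in u.

Section refinement.
Variables (S : step_process Omega R) (T : R) (u : seq R).
Hypotheses (aS : step_adapted F S) (su : sorted <%R u)
  (uT : forall x, x \in u -> x <= T) (ru : refines T u S).

Lemma step_integral_refined w : step_integral S W T w =
  \sum_(l < (size u).-1) step_value S u`_l.+1 w * (W u`_l.+1 w - W u`_l w).
Proof.
have [_ tm _] := aS.
rewrite /step_integral /step_value; under [RHS]eq_bigr do rewrite mulr_suml.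
rewrite exchange_big/=; apply: eq_bigr => i _.
under eq_bigr do rewrite -mulrA; rewrite -mulr_sumr; congr (_ * _).
rewrite [LHS](_ : _ = (W (Num.min (sp_time S i.+1) T) w - W u`_0 w) -
  (W (Num.min (sp_time S i) T) w - W u`_0 w)); last by ring.
rewrite (telescope_partition (W^~ w) su (ru (ltn_ord i))).
rewrite (telescope_partition (W^~ w) su (ru (ltnW (ltn_ord i)))).
rewrite -sumrB; apply: eq_bigr => l _; rewrite -mulrBl; congr (_ * _).
rewrite (@indic_itv_min _ _ _ _ T)//; first exact: tm.
by apply: uT; rewrite mem_nth// ord_pred_ltn.
Qed.

Let indic_refined i l x : (i < sp_size S)%N -> (l.+1 < size u)%N ->
  u`_l < x -> x <= u`_l.+1 ->
  \1_(`]sp_time S i, sp_time S i.+1]%classic) x =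
  (Num.min (sp_time S i) T <= u`_l)%R%:R -
  (Num.min (sp_time S i.+1) T <= u`_l)%R%:R :> R.
Proof.
move=> iS lu lx xl; have [_ tm _] := aS.
have xT : x <= T by apply: le_trans xl _; apply: uT; exact: mem_nth.
have le_ul y : y \in u -> (x <= y) = ~~ (y <= u`_l).
  move=> yu; rewrite -ltNge; apply/idP/idP => [xy|]; first exact: lt_le_trans xy.
  by rewrite ltNge -(sorted_gap su yu lu) -leNgt; exact: le_trans.
rewrite (@indic_itv_min _ _ _ _ T)//; last exact: tm.
rewrite !le_ul; [|exact/ru/ltnW|exact: ru].
by case: (_ <= _); case: (_ <= _) => /=; ring.
Qed.

Lemma step_value_refined w l x : (l.+1 < size u)%N -> u`_l < x -> x <= u`_l.+1 ->
  step_value S x w = step_value S u`_l.+1 w.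
Proof.
move=> lu lx xl; apply: eq_bigr => i _.
rewrite !(@indic_refined i l)//; exact: lt_le_trans xl.
Qed.

(** The value on a cell is known at its left end: a step that has not begun
    by then does not cover the cell. *)
Lemma step_value_refined_measurable l : (l.+1 < size u)%N -> 0 <= u`_l ->
  measurable_wrt (F u`_l) (step_value S u`_l.+1).
Proof.
move=> lu ul0; have [_ tm mc] := aS; have [sF Fm Fle] := hF.
have lt_ul : u`_l < u`_l.+1 by rewrite (lt_sorted_ltn_nth 0 su) ?inE// ltnW.
apply/(measurable_wrtP (sF _ ul0)); apply: measurable_sum => i.
rewrite (_ : (fun _ => _) = fun w => sp_coef S i w *
   ((Num.min (sp_time S i) T <= u`_l)%R%:R -
    (Num.min (sp_time S i.+1) T <= u`_l)%R%:R)); last first.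
  by apply/funext => w; rewrite (@indic_refined i l).
have [iu|iu] := leP (sp_time S i) u`_l.
  apply: measurable_funM => //; apply/(measurable_wrtP (sF _ ul0)).
  move=> B mB; apply: (Fle (sp_time S i)) => //; first exact: step_time_ge0.
  exact: mc.
have ulT : u`_l < T by apply: lt_le_trans lt_ul _; apply: uT; exact: mem_nth.
have iu' : u`_l < sp_time S i.+1 by apply: lt_le_trans iu _; exact: tm.
rewrite (_ : (fun _ => _) = cst 0)//; apply/funext => w.
by rewrite !leNgt !lt_min iu iu' ulT /= subrr mulr0.
Qed.

End refinement.

Lemma merged_partition (S1 S2 : step_process Omega R) (T : R) : 0 <= T ->
  step_adapted F S1 -> step_adapted F S2 ->
  exists u : seq R, [/\ sorted <%R u, (0 < size u)%N,
    u`_0 = 0 /\ u`_(size u).-1 = T, (forall x, x \in u -> 0 <= x <= T) &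
    refines T u S1 /\ refines T u S2].
Proof.
move=> T0 a1 a2.
pose times S := [seq Num.min (sp_time S i) T | i <- iota 0 (sp_size S).+1].
pose v := 0 :: T :: times S1 ++ times S2.
have timesP S : refines T (times S) S.
  by move=> i iS; apply/mapP; exists i => //; rewrite mem_iota.
have times_itv S : step_adapted F S -> forall x, x \in times S -> 0 <= x <= T.
  move=> aS x /mapP[i _ ->]; rewrite ge_min lexx orbT andbT le_min T0 andbT.
  exact: step_time_ge0.
pose u := sort <=%R (undup v).
have uE x : (x \in u) = (x \in v) by rewrite mem_sort mem_undup.
have su : sorted <%R u by rewrite sort_lt_sorted undup_uniq.
have u0 : 0 \in u by rewrite uE inE eqxx.
have uT : T \in u by rewrite uE !inE eqxx orbT.
have uitv x : x \in u -> 0 <= x <= T.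
  rewrite uE /v in_cons in_cons mem_cat => /predU1P[->|/predU1P[->|/orP[]]].
  - by rewrite lexx T0.
  - by rewrite lexx T0.
  - exact: (times_itv _ a1).
  - exact: (times_itv _ a2).
have usz : (0 < size u)%N by apply: contraTT u0; rewrite -eqn0Ngt => /eqP/size0nil ->.
have usz' : ((size u).-1 < size u)%N by rewrite prednK.
exists u; split => //; split.
- apply/eqP; rewrite eq_le; have /andP[-> _] := uitv _ (mem_nth 0 usz).
  move: u0 => /(nthP 0)[p pu pE].
  by rewrite andbT -[leRHS]pE (lt_sorted_leq_nth 0 su) ?inE.
- apply/eqP; rewrite eq_le; have /andP[_ ->] := uitv _ (mem_nth 0 usz').
  move: uT => /(nthP 0)[p pu pE].
  by rewrite /= -[leLHS]pE (lt_sorted_leq_nth 0 su) ?inE// -ltnS prednK.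
- by move=> i iS; rewrite uE /v in_cons in_cons mem_cat timesP ?orbT.
- by move=> i iS; rewrite uE /v in_cons in_cons mem_cat timesP ?orbT.
Qed.

Lemma measurable_step_value S w : measurable_fun setT (fun x => step_value S x w).
Proof.
by apply: measurable_sum => i; apply: measurable_funM => //; exact: measurable_indic.
Qed.

Lemma step_energy_refined (S1 S2 : step_process Omega R) (T : R) (u : seq R) w :
  step_adapted F S1 -> step_adapted F S2 -> sorted <%R u -> (0 < size u)%N ->
  u`_0 = 0 -> u`_(size u).-1 = T -> (forall x, x \in u -> x <= T) ->
  refines T u S1 -> refines T u S2 ->
  \int[lebesgue_measure]_(x in `[0, T])
    (step_value S1 x w - step_value S2 x w) ^+ 2 =
  \sum_(l < (size u).-1) (step_value S1 u`_l.+1 w - step_value S2 u`_l.+1 w) ^+ 2 *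
    (u`_l.+1 - u`_l).
Proof.
move=> a1 a2 su usz u0 uT ultT r1 r2.
rewrite /Rintegral -{1}u0 -[in `[_, T]]uT integral_partition ?prednK//=.
- by move=> x; exact: sqr_ge0.
- by apply: measurable_funX; apply: measurable_funB; exact: measurable_step_value.
- move=> j x jL jx xj; have ju : (j.+1 < size u)%N by rewrite -ltn_predRL.
  rewrite (step_value_refined a1 su ultT r1 w ju jx xj).
  by rewrite (step_value_refined a2 su ultT r2 w ju jx xj).
Qed.

Lemma measurable_sp_coef S i : step_adapted F S -> (i < sp_size S)%N ->
  measurable_fun setT (sp_coef S i).
Proof.
move=> aS iS; have [sF Fm _] := hF; have [_ _ /(_ _ iS) mc] := aS.
have t0 := step_time_ge0 i aS.
exact: (measurable_fun_sub (sF _ t0) (Fm _ t0)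
  ((measurable_wrtP (sF _ t0) _).1 mc)).
Qed.

Lemma measurable_step_value_path S x : step_adapted F S ->
  measurable_fun setT (step_value S x).
Proof.
move=> aS; apply: measurable_sum => i; apply: measurable_funM => //.
exact: measurable_sp_coef.
Qed.

Lemma measurable_step_energy (S1 S2 : step_process Omega R) (T : R) : 0 <= T ->
  step_adapted F S1 -> step_adapted F S2 ->
  measurable_fun setT (fun w => \int[lebesgue_measure]_(x in `[0, T])
    (step_value S1 x w - step_value S2 x w) ^+ 2).
Proof.
move=> T0 a1 a2.
have [u [su usz [u0 uT] uitv [r1 r2]]] := merged_partition T0 a1 a2.
have ultT x : x \in u -> x <= T by move=> /uitv/andP[].
under eq_fun do rewrite (step_energy_refined _ a1 a2 su usz u0 uT ultT r1 r2).
apply: measurable_sum => l; apply: measurable_funM => //.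
by apply: measurable_funX; apply: measurable_funB; exact: measurable_step_value_path.
Qed.

Lemma measurable_step_integral S (T : R) : 0 <= T -> step_adapted F S ->
  measurable_fun setT (step_integral S W T).
Proof.
move=> T0 aS; have [sF Fm _] := hF; have [mW _] := hW.
have mWT i : measurable_fun setT (W (Num.min (sp_time S i) T)).
  have t0 : 0 <= Num.min (sp_time S i) T by rewrite le_min T0 step_time_ge0.
  exact: (measurable_fun_sub (sF _ t0) (Fm _ t0)
    ((measurable_wrtP (sF _ t0) _).1 (mW _ t0))).
apply: measurable_sum => i; apply: measurable_funM.
  exact: measurable_sp_coef.
exact: measurable_funB.
Qed.

(** On a common refinement the difference of two step integrals is a single
    martingale transform. *)
Lemma step_integral_tail (S1 S2 : step_process Omega R) (T delta e : R) : 0 <= T ->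
  step_adapted F S1 -> step_adapted F S2 -> 0 <= delta -> 0 < e ->
  (P [set w | (e <= `|step_integral S1 W T w - step_integral S2 W T w|)%R] <=
   P [set w | (delta < \int[lebesgue_measure]_(x in `[0, T])
       (step_value S1 x w - step_value S2 x w) ^+ 2)%R] +
   (8 * delta / e ^+ 2)%:E)%E.
Proof.
move=> T0 a1 a2 d0 e0.
have [u [su usz [u0 uT] uitv [r1 r2]]] := merged_partition T0 a1 a2.
have [sF Fm Fle] := hF; have [mW indepW] := hW.
set L := (size u).-1.
have Lu l : (l <= L)%N -> (l < size u)%N by move=> lL; rewrite -(prednK usz) ltnS.
have LSu l : (l < L)%N -> (l.+1 < size u)%N by move=> lL; exact: Lu.
have ul0 l : (l <= L)%N -> 0 <= u`_l.
  by move=> lL; have /andP[] := uitv _ (mem_nth 0 (Lu _ lL)).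
have ultT x : x \in u -> x <= T by move=> /uitv/andP[].
have lt_u l : (l < L)%N -> u`_l < u`_l.+1.
  by move=> lL; rewrite (lt_sorted_ltn_nth 0 su) ?inE ?LSu// ltnW// LSu.
pose c l w := step_value S1 u`_l.+1 w - step_value S2 u`_l.+1 w.
pose xi l w := W u`_l.+1 w - W u`_l w.
pose s l := Num.sqrt (u`_l.+1 - u`_l).
have := @martingale_transform_tail _ _ _ P L (fun l => F u`_l) c xi s.
move=> /(_ _ _ _ _ _ _ _ delta e d0 e0) H.
rewrite [X in P X](_ : _ = [set w | e <= `|\sum_(j < L) c j w * xi j w|]); last first.
  apply/funext => w /=; congr (_ <= `|_|).
  rewrite !(@step_integral_refined _ _ u)// -sumrB.
  by apply: eq_bigr => j _; rewrite -mulrBl.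
rewrite [X in (_ <= P X + _)%E](_ : _ =
    [set w | delta < \sum_(j < L) c j w ^+ 2 * s j ^+ 2]); last first.
  apply/funext => w /=; congr (_ < _).
  rewrite (step_energy_refined _ a1 a2 su usz u0 uT ultT r1 r2).
  by apply: eq_bigr => j _; rewrite /c /s sqr_sqrtr// subr_ge0 ltW// lt_u.
apply: H.
- by move=> l lL; apply: sF; exact: ul0.
- by move=> l lL; apply: Fm; exact: ul0.
- move=> j l jl lL; apply: Fle; first by apply: ul0; exact: leq_trans lL.
  by rewrite (lt_sorted_leq_nth 0 su) ?inE ?Lu// (leq_trans jl).
- move=> l lL; have l0 := ul0 _ (ltnW lL).
  apply/(measurable_wrtP (sF _ l0)); apply: measurable_funB.
    apply/(measurable_wrtP (sF _ l0)).
    exact: (step_value_refined_measurable a1 su ultT r1 (LSu _ lL) l0).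
  apply/(measurable_wrtP (sF _ l0)).
  exact: (step_value_refined_measurable a2 su ultT r2 (LSu _ lL) l0).
- move=> l lL; have l0 := ul0 _ lL.
  apply/(measurable_wrtP (sF _ l0)); apply: measurable_funB.
    by apply/(measurable_wrtP (sF _ l0)); exact: mW.
  apply/(measurable_wrtP (sF _ l0)) => B mB; apply: (Fle u`_l).
  + exact: ul0 (ltnW lL).
  + exact/ltW/lt_u.
  + by apply: mW => //; exact: ul0 (ltnW lL).
- by move=> l lL; rewrite sqrtr_eq0 -ltNge subr_gt0 lt_u.
- by move=> l lL C B FC mB; apply: indepW => //; [exact: ul0 (ltnW lL)|exact: lt_u].
Qed.

End step_processes.

(** * Continuous paths *)

Section paths.
Variable R : realType.
Implicit Types (f g : R -> R) (T e : R).

Lemma path_cvgP f : {within `[0, +oo[, continuous f} -> forall x e, 0 <= x ->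
  0 < e -> exists2 d : R, 0 < d & forall y, 0 <= y -> `|y - x| < d -> `|f y - f x| < e.
Proof.
move=> /subspace_continuousP cf x e x0 e0.
have /cf/cvgrPdist_lt/(_ _ e0) : `[0, +oo[%classic x by rewrite /= in_itv/= x0.
rewrite near_withinE => -[d /= d0 H]; exists d => // y y0 yx.
by rewrite distrC; apply: H; rewrite /= ?in_itv/= ?y0//; rewrite /ball/= distrC.
Qed.

(** The Heine-Cantor theorem on [0, T]; the point [y] may leave the segment. *)
Lemma path_unif_continuous f T e : {within `[0, +oo[, continuous f} -> 0 < e ->
  exists2 d : R, 0 < d & forall x y, 0 <= x <= T -> 0 <= y ->
    `|y - x| < d -> `|f y - f x| <= e.
Proof.
move=> cf e0.
have /compact_near_coveringP := @segment_compact R 0 T.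
move=> /(_ R 0^'+ (fun d x => forall y, 0 <= x -> 0 <= y -> `|y - x| < d ->
  `|f y - f x| <= e) _) H.
have /H : forall x : R, `[0, T]%classic x -> \forall x' \near x & i \near 0^'+,
  forall y, 0 <= x' -> 0 <= y -> `|y - x'| < i -> `|f y - f x'| <= e.
  move=> x /=; rewrite in_itv/= => /andP[x0 _].
  have e20 : 0 < e / 2 by rewrite divr_gt0.
  have [d d0 cfd] := path_cvgP cf x0 e20.
  have d20 : 0 < d / 2 by rewrite divr_gt0.
  exists (ball x (d / 2), [set i | 0 < i < d / 2]) => /=.
    split; first exact: nbhsx_ballx.
    exists (d / 2) => //= i /= + i0; rewrite sub0r normrN i0/=.
    by rewrite gtr0_norm.
  move=> [x' i]/= [xx' /andP[i0 id]] y x'0 y0 yx'.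
  have xx : `|x' - x| < d / 2 by rewrite distrC.
  have fx' : `|f x' - f x| < e / 2.
    by apply: cfd => //; apply: lt_trans xx _; rewrite ltr_pdivrMr//; lra.
  have fy : `|f y - f x| < e / 2.
    apply: cfd => //; rewrite -(subrKA x').
    apply: le_lt_trans (ler_normD _ _) _; lra.
  rewrite -(subrKA (f x)); apply: le_trans (ler_normD _ _) _.
  by rewrite [X in _ + X <= _]distrC; lra.
move=> [d /= d0 Hd]; exists (d / 2); first by rewrite divr_gt0.
move=> x y /andP[x0 xT] y0 yx.
apply: (Hd (d / 2)) => //=; last by rewrite in_itv/= x0.
- rewrite sub0r normrN gtr0_norm ?divr_gt0//; lra.
- by rewrite divr_gt0.
Qed.

Lemma path_bounded f T : {within `[0, +oo[, continuous f} ->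
  exists2 M : R, 0 <= M & forall x, 0 <= x <= T -> `|f x| <= M.
Proof.
move=> cf; have /compact_near_coveringP := @segment_compact R 0 T.
move=> /(_ R +oo (fun M x => 0 <= x -> `|f x| <= M) _) H.
have /H : forall x : R, `[0, T]%classic x -> \forall x' \near x & M \near +oo,
  0 <= x' -> `|f x'| <= M.
  move=> x /=; rewrite in_itv/= => /andP[x0 _].
  have [d d0 cfd] := path_cvgP cf x0 ltr01.
  exists (ball x d, [set M | `|f x| + 1 < M]) => /=.
    split; first exact: nbhsx_ballx.
    by apply: nbhs_pinfty_gt; rewrite num_real.
  move=> [x' M]/= [xx' fM] x'0.
  have fx' : `|f x' - f x| < 1 by apply: cfd => //; rewrite distrC.
  rewrite -(subrK (f x) (f x')); apply: le_trans (ler_normD _ _) _; lra.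
move=> [M [_ HM]]; exists (Num.max 0 (M + 1)); first by rewrite le_max lexx.
move=> x /andP[x0 xT]; rewrite le_max; apply/orP; right.
by apply: (HM (M + 1)) => //=; [lra|rewrite in_itv/= x0].
Qed.

Lemma path_measurable f T : {within `[0, +oo[, continuous f} ->
  measurable_fun `[0, T] f.
Proof.
move=> cf; apply: (@subspace_continuous_measurable_fun _ `[0, T]%classic) => //.
apply: continuous_subspaceW cf => x /=; rewrite !in_itv/= => /andP[-> _] //.
Qed.

Lemma path_integrable f a b : {within `[0, +oo[, continuous f} -> 0 <= a ->
  lebesgue_measure.-integrable `[a, b] (EFin \o f).
Proof.
move=> cf a0; apply: continuous_compact_integrable; first exact: segment_compact.
apply: continuous_subspaceW cf => x /=; rewrite !in_itv/= andbT => /andP[ax _].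
exact: le_trans ax.
Qed.

Lemma pathM f g : {within `[0, +oo[, continuous f} ->
  {within `[0, +oo[, continuous g} ->
  {within `[0, +oo[, continuous (fun t => f t * g t)}.
Proof. by move=> cf cg x; apply: continuousM; [exact: cf|exact: cg]. Qed.

Lemma path_comp f (h : R -> R) : {within `[0, +oo[, continuous f} ->
  continuous h -> {within `[0, +oo[, continuous (fun t => h (f t))}.
Proof. by move=> cf ch x; apply: continuous_comp; [exact: cf|exact: ch]. Qed.

End paths.

(** * Ito integrals as limits of left-point sums *)

Section convergence_in_probability.
Context d (Omega : measurableType d) (R : realType) (P : probability Omega R).

Lemma cvg_probability0P (A : nat -> set Omega) :
  (P (A n) @[n --> \oo] --> 0%E) <->
  forall e : R, 0 < e -> \forall n \near \oo, (P (A n) <= e%:E)%E.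
Proof.
split=> [/fine_cvgP[fin_num /cvgr0Pnorm_le cvg0] e e0|small].
  move: (cvg0 e e0); apply: filterS2 fin_num => n /= fn.
  by rewrite -lee_fin -abse_EFin fineK// gee0_abs.
have fin (e : R) : 0 < e -> \forall n \near \oo, P (A n) \is a fin_num.
  move=> e0; move: (small e e0); apply: filterS => n PAe.
  by rewrite ge0_fin_numE//; apply: le_lt_trans PAe _; rewrite ltry.
apply/fine_cvgP; split; first exact: (fin 1 ltr01).
apply/cvgr0Pnorm_le => e e0; near=> n => /=.
rewrite -lee_fin -abse_EFin fineK; last by near: n; exact: (fin e).
by rewrite gee0_abs//; near: n; exact: small.
Unshelve. all: by end_near. Qed.

Lemma measurable_dist_ge (f g : Omega -> R) (c : R) :
  measurable_fun setT f -> measurable_fun setT g ->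
  measurable [set w | c <= `|f w - g w|].
Proof.
move=> mf mg; rewrite -[X in measurable X]setTI.
apply: (@measurable_fun_ler _ _ _ _ (cst c)) => //.
by apply: measurableT_comp => //; exact: measurable_funB.
Qed.

Lemma cvg_pointwise_probability (f : nat -> Omega -> R) (g : Omega -> R) (e : R) :
  (forall n, measurable_fun setT (f n)) -> measurable_fun setT g -> 0 < e ->
  (forall w, f n w @[n --> \oo] --> g w) ->
  P [set w | e <= `|f n w - g w|] @[n --> \oo] --> 0%E.
Proof.
move=> mf mg e0 fg; pose E n := [set w | e <= `|f n w - g w|].
have mE n : measurable (E n) by exact: measurable_dist_ge.
have lim0 : lim_sup_set E = set0.
  rewrite -subset0 => w limE; have /cvgrPdist_lt/(_ _ e0)[N _ HN] := fg w.
  have [n /= Nn] := limE N I.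
  by rewrite /E /= distrC leNgt HN.
have := lim_sup_set_cvg P E mE _.
rewrite lim0 measure0 => cvgU.
have {}cvgU := cvgU _.
apply: (squeeze_cvge _ (cvg_cst 0%E) (cvgU _)).
- near=> n; rewrite measure_ge0/=; apply: le_measure; rewrite ?inE.
  + exact: mE.
  + exact: bigcup_measurable.
  by move=> w Ew; exists n => /=.
- apply: le_lt_trans (probability_le1 P _) _; last exact: ltry.
  exact: bigcup_measurable.
Unshelve. all: by end_near. Qed.

End convergence_in_probability.

Section left_point_sums.
Context d (Omega : measurableType d) (R : realType) (P : probability Omega R).
Variables (F : R -> set (set Omega)) (W H : R -> Omega -> R).
Hypotheses (hF : filtration F) (hW : gaussian_increments P F W)
  (hH : continuous_adapted F H).
Variable T : R.
Hypothesis T0 : 0 <= T.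

Definition left_step (K : nat) : step_process Omega R :=
  StepProcess (2 ^ K) (fun i => i%:R * (T / (2 ^ K)%:R))
    (fun i => H (i%:R * (T / (2 ^ K)%:R))).

Let mesh_ge0 K : 0 <= T / (2 ^ K)%:R. Proof. exact: divr_ge0. Qed.

Lemma left_step_adapted K : step_adapted F (left_step K).
Proof.
split => /=; first by rewrite mul0r.
- by move=> i j ij; rewrite ler_wpM2r// ler_nat.
- by move=> i _; apply: hH.1; rewrite mulr_ge0.
Qed.

Lemma left_step_integral K w : step_integral (left_step K) W T w =
  \sum_(i < 2 ^ K) H (i%:R * (T / (2 ^ K)%:R)) w *
    (W (i.+1%:R * (T / (2 ^ K)%:R)) w - W (i%:R * (T / (2 ^ K)%:R)) w).
Proof.
have iT i : (i <= 2 ^ K)%N -> i%:R * (T / (2 ^ K)%:R) <= T.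
  move=> iK; rewrite mulrCA ler_piMr// ler_pdivrMr ?ltr0n ?expn_gt0//.
  by rewrite mul1r ler_nat.
by apply: eq_bigr => i _ /=; rewrite !min_l// iT// ltnW.
Qed.

Lemma left_step_value K w x : 0 < x <= T -> exists y,
  [/\ 0 <= y <= T, `|y - x| <= T / (2 ^ K)%:R &
      step_value (left_step K) x w = H y w].
Proof.
move=> /andP[x0 xT]; set h := T / (2 ^ K)%:R.
have K0 : (2 ^ K)%:R != 0 :> R by rewrite pnatr_eq0 -lt0n expn_gt0.
have ex : exists i, x <= i.+1%:R * h.
  by exists (2 ^ K).-1; rewrite prednK ?expn_gt0// /h mulrC divfK.
case: (ex_minnP ex) => i xi imin.
have iK : (i < 2 ^ K)%N.
  rewrite -[(2 ^ K)%N]prednK ?expn_gt0// ltnS; apply: imin.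
  by rewrite prednK ?expn_gt0// /h mulrC divfK.
have ix : i%:R * h < x.
  case: i imin {xi iK} => [|i] imin; first by rewrite mul0r.
  by rewrite ltNge; apply/negP => /imin; rewrite ltnn.
exists (i%:R * h); split.
- by rewrite mulr_ge0 ?mesh_ge0//= (le_trans (ltW ix)).
- rewrite ler_norml; move: xi; rewrite -natr1 mulrDl mul1r => xi.
  by apply/andP; split; lra.
rewrite /step_value /= (bigD1 (Ordinal iK))//= big1 ?addr0.
  by rewrite indicE mem_setE in_itv/= -/h ix xi mulr1.
move=> j ji; rewrite indicE mem_setE in_itv/= -/h.
suff -> : (j%:R * h < x <= j.+1%:R * h) = false by rewrite mulr0.
apply/negP => /andP[jx xj].
have /imin ij := xj.
have h0 : 0 <= h by exact: mesh_ge0.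
have : (i < j)%N by rewrite ltn_neqAle ij andbT eq_sym; exact: ji.
move=> ij'; have : i.+1%:R * h <= j%:R * h by rewrite ler_wpM2r// ler_nat.
by move=> /(le_trans xi); rewrite leNgt jx.
Qed.

Let mesh_small (e : R) : 0 < e -> \forall K \near \oo, T / (2 ^ K)%:R < e.
Proof.
move=> e0; near=> K; rewrite ltr_pdivrMr ?ltr0n ?expn_gt0//.
rewrite mulrC -ltr_pdivrMr//; apply: (@lt_trans _ _ K%:R).
  by near: K; exact: nbhs_infty_gtr.
by rewrite ltr_nat ltn_expl.
Unshelve. all: by end_near. Qed.

Lemma left_step_value_cvg w x : 0 < x <= T ->
  step_value (left_step K) x w @[K --> \oo] --> H x w.
Proof.
move=> xT; apply/cvgrPdist_lt => e e0.
have x0 : 0 <= x by case/andP: xT => /ltW.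
have [dl dl0 Hd] := path_cvgP (hH.2 w) x0 e0.
near=> K; have [y [/andP[y0 _] yx ->]] := left_step_value K w xT.
rewrite distrC; apply: Hd => //; apply: le_lt_trans yx _.
by near: K; exact: mesh_small.
Unshelve. all: by end_near. Qed.

(** Dominated convergence along each path. *)
Lemma left_energy_cvg (S : step_process Omega R) w :
  \int[lebesgue_measure]_(x in `[0, T])
    (step_value S x w - step_value (left_step K) x w) ^+ 2 @[K --> \oo] -->
  \int[lebesgue_measure]_(x in `[0, T]) (step_value S x w - H x w) ^+ 2.
Proof.
have [M M0 HM] := path_bounded T (hH.2 w).
pose C := \sum_(i < sp_size S) `|sp_coef S i w|.
have SC x : `|step_value S x w| <= C.
  apply: le_trans (ler_norm_sum _ _ _) _; apply: ler_sum => i _.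
  rewrite normrM ler_piMr// indicE; case: (_ \in _); rewrite ?normr1 ?normr0//.
have mH : measurable_fun `[0, T] (H^~ w) by exact: path_measurable (hH.2 w).
(* the left-open cells miss the origin, a null set *)
have ae0 (Q : R -> Prop) : (forall x, (`[0, T]%classic x -> 0 < x <= T) -> Q x) ->
    {ae (@lebesgue_measure R), forall x, Q x}.
  move=> hQ; exists [set 0]; split => //; first exact: lebesgue_measure_set1.
  move=> x /=; apply: contra_notP => /eqP x0; apply: hQ.
  by rewrite /= in_itv/= => /andP[x0' ->]; rewrite lt_neqAle eq_sym x0 x0'.
have [ |||||fint _ cvgI] := @dominated_convergence _ _ _ (@lebesgue_measure R)
    `[0, T]%classic (measurable_itv _)
    (fun K x => ((step_value S x w - step_value (left_step K) x w) ^+ 2)%:E)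
    (fun x => ((step_value S x w - H x w) ^+ 2)%:E)
    (cst ((C + M) ^+ 2)%:E).
- move=> K; apply/measurable_EFinP; apply: measurable_funTS.
  apply: measurable_funX; apply: measurable_funB; exact: measurable_step_value.
- apply/measurable_EFinP; apply: measurable_funX; apply: measurable_funB => //.
  apply: measurable_funTS; exact: measurable_step_value.
- apply: ae0 => x hx /hx xT; apply: cvg_EFin; first exact: nearW.
  apply: cvgM; apply: cvgB; try exact: cvg_cst; exact: left_step_value_cvg.
- apply/integrableP; split; first exact: measurable_cst.
  rewrite integral_cst//= lebesgue_measure_itv/=.
  by case: ifP => _; rewrite ?mule0 -?EFinD -?EFinM ltry.
- apply: ae0 => x hx K /hx xT; rewrite abse_EFin lee_fin normrX.
  apply: lerXn2r; rewrite ?nnegrE//.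
    by rewrite addr_ge0//; apply: sumr_ge0 => i _.
  apply: le_trans (ler_normB _ _) _; apply: lerD => //.
  by have [y [yT _ ->]] := left_step_value K w xT; exact: HM.
apply: fine_cvg; rewrite fineK//; exact: integrable_fin_num.
Qed.

(** The approximating sequence [S] given with the Ito integral and the left-point
    steps are both close to [H] in [L^2], so the tail bound makes their
    integrals close.  The index [n] of [S] is fixed before [K] goes to infinity:
    all random variables in sight are then measurable, since the energy of
    [S n - H] is so by assumption. *)
Lemma ito_integral_left_sums X : is_ito_integral P F W H T X ->
  cvg_in_probability P (fun K => step_integral (left_step K) W T) X.
Proof.
move=> [S [aS [mV _ cvgV] [mI mX cvgI]]]; split => //.
  by move=> K; apply: (measurable_step_integral hF hW) => //; exact: left_step_adapted.
move=> e e0; apply/cvg_probability0P => eps eps0.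
have e20 : 0 < e / 2 by rewrite divr_gt0.
have eps4 : 0 < eps / 4 by rewrite divr_gt0.
(* [delta] makes the second term of the tail bound at most [eps / 4] *)
pose delta := eps / 4 * (e / 2) ^+ 2 / 8.
have delta0 : 0 < delta by rewrite divr_gt0// mulr_gt0// exprn_gt0.
have delta20 : 0 < delta / 2 by rewrite divr_gt0.
move: cvgV => /(_ _ delta20)/cvg_probability0P/(_ _ eps4) smallV.
move: cvgI => /(_ _ e20)/cvg_probability0P/(_ _ eps4) smallI.
have [n [{}smallV {}smallI]] := filter_ex (filterI smallV smallI).
pose En K w := \int[lebesgue_measure]_(x in `[0, T])
    (step_value (S n) x w - step_value (left_step K) x w) ^+ 2.
pose Vn w := \int[lebesgue_measure]_(x in `[0, T])
    (step_value (S n) x w - H x w) ^+ 2.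
have mEn K : measurable_fun setT (En K).
  by apply: (measurable_step_energy hF T0 (aS n)); exact: left_step_adapted.
have := cvg_pointwise_probability P mEn (mV n) delta20 (@left_energy_cvg (S n)).
move=> /cvg_probability0P/(_ _ eps4); apply: filterS => K smallE.
pose A := [set w | e / 2 <= `|step_integral (S n) W T w - X w|].
pose B := [set w | e / 2 <= `|step_integral (S n) W T w -
  step_integral (left_step K) W T w|].
pose C := [set w | delta < En K w].
pose D1 := [set w | delta / 2 <= `|Vn w - cst 0 w|].
pose D2 := [set w | delta / 2 <= `|En K w - Vn w|].
have mIK : measurable_fun setT (step_integral (left_step K) W T).
  by apply: (measurable_step_integral hF hW) => //; exact: left_step_adapted.
have mA : measurable A by exact: measurable_dist_ge.
have mB : measurable B by exact: measurable_dist_ge.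
have mD1 : measurable D1 by apply: measurable_dist_ge => //; exact: mV.
have mD2 : measurable D2 by apply: measurable_dist_ge => //; exact: mV.
have mC : measurable C.
  rewrite (_ : C = En K @^-1` `]delta, +oo[); last first.
    by apply/seteqP; split => w /=; rewrite in_itv/= andbT.
  by rewrite -[_ @^-1` _]setTI; exact: mEn.
have PC : (P C <= (eps / 4)%:E + (eps / 4)%:E)%E.
  apply: (@le_trans _ _ (P (D1 `|` D2))).
    apply: le_measure; rewrite ?inE//; first exact: measurableU.
    move=> w; rewrite /C /D1 /D2 /= subr0 => dE.
    have [|VnD] := leP (delta / 2) `|Vn w|; first by left.
    right; have := ler_norm (En K w - Vn w); have := ler_norm (Vn w); lra.
  apply: le_trans (measureU2 _ mD1 mD2) _; exact: leeD.
have PB : (P B <= (eps / 4)%:E + (eps / 4)%:E + (eps / 4)%:E)%E.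
  have := step_integral_tail hF hW T0 (aS n) (left_step_adapted K) (ltW delta0) e20.
  rewrite (_ : 8 * delta / (e / 2) ^+ 2 = eps / 4); last first.
    by rewrite /delta; field; rewrite gt_eqF.
  move=> /le_trans; apply; exact: leeD2r.
apply: (@le_trans _ _ (P (A `|` B))).
  apply: le_measure; rewrite ?inE//; [exact: measurable_dist_ge|exact: measurableU|].
  move=> w; rewrite /A /B /= => eI.
  have [|] := leP (e / 2) `|step_integral (S n) W T w - X w|; first by left.
  move=> IX; right.
  have := ler_normD (step_integral (left_step K) W T w - step_integral (S n) W T w)
    (step_integral (S n) W T w - X w).
  by rewrite subrKA [X in _ <= X + _]distrC; lra.
apply: le_trans (measureU2 _ mA mB) _.
apply: (@le_trans _ _ ((eps / 4)%:E + ((eps / 4)%:E + (eps / 4)%:E + (eps / 4)%:E))%E).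
  exact: leeD.
by rewrite -!EFinD lee_fin; lra.
Qed.

End left_point_sums.

(** * The Euler scheme for linear equations *)

Section euler_scheme.
Variable R : realType.
Local Notation mu := (@lebesgue_measure R).

(** The explicit Euler scheme for [dy = - a y dt + dm], with step [h], rates
    [a i] and driving increments [dm i]. *)
Fixpoint euler (h : R) (a dm : nat -> R) (y0 : R) (j : nat) : R :=
  if j is i.+1 then (1 - a i * h) * euler h a dm y0 i + dm i else y0.

Lemma Rintegral_left_point (f : R -> R) (s t e : R) :
  {within `[0, +oo[, continuous f} -> 0 <= s -> s <= t ->
  (forall x, s <= x <= t -> `|f x - f s| <= e) ->
  `|\int[mu]_(x in `[0, t]) f x - \int[mu]_(x in `[0, s]) f x - f s * (t - s)| <=
  e * (t - s).
Proof.
move=> cf s0 st fe.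
have int0 : mu.-integrable `[0, t] (EFin \o f) by exact: path_integrable.
have ints : mu.-integrable `]s, t] (EFin \o f).
  by apply: integrableS int0 => //; apply: subset_itvr; rewrite bnd_simp.
have lst : mu `]s, t]%classic = (t - s)%:E.
  rewrite /= lebesgue_measure_itv/= lte_fin EFinB; case: ltP => // ts.
  by rewrite (@le_anti _ _ s t) ?st// subee.
have ic (c : R) : mu.-integrable `]s, t] (EFin \o cst c).
  apply/integrableP; split; first by apply/measurable_EFinP; exact: measurable_cst.
  rewrite (eq_integral (cst `|c|%:E)); last by move=> x _ /=.
  by rewrite integral_cst//= [X in (_ * X)%E]lst -EFinM ltry.
have cstE (c : R) : \int[mu]_(x in `]s, t]) c = c * (t - s).
  by rewrite (@Rintegral_cst _ _ _ mu)//= lst.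
rewrite Rintegral_itvB ?bnd_simp//.
rewrite -(cstE (f s)) -RintegralB//; last exact: ic.
apply: le_trans (le_normr_Rintegral _ _) _ => //.
  exact: (integrableB _ ints (ic (f s))).
rewrite -(cstE e); apply: le_Rintegral => //.
- by apply: integrable_norm; exact: (integrableB _ ints (ic (f s))).
- exact: ic.
move=> x /=; rewrite in_itv/= => /andP[sx xt]; apply: fe.
by rewrite ltW.
Qed.

(** Once [a h <= 1] the scheme is a contraction, so the local errors, each at
    most [h] times the modulus of continuity of [a y], simply add up. *)
Lemma euler_cvg (y a m : R -> R) (T : R) : 0 <= T ->
  {within `[0, +oo[, continuous y} -> {within `[0, +oo[, continuous a} ->
  (forall x, 0 <= x -> 0 <= a x) ->
  (forall K j, (j <= 2 ^ K)%N -> let t := j%:R * (T / (2 ^ K)%:R) in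
     y t = y 0 + \int[mu]_(x in `[0, t]) (- a x * y x) + m t) ->
  euler (T / (2 ^ K)%:R) (fun i => a (i%:R * (T / (2 ^ K)%:R)))
    (fun i => m (i.+1%:R * (T / (2 ^ K)%:R)) - m (i%:R * (T / (2 ^ K)%:R)))
    (y 0) (2 ^ K) @[K --> \oo] --> y T.
Proof.
move=> T0 cy ca a0 eqn.
have cay : {within `[0, +oo[, continuous (fun x => - a x * y x)}.
  by apply: pathM => // x; apply: continuousN; exact: ca.
apply/cvgrPdist_le => e e0.
have e'0 : 0 < e / (T + 1) by rewrite divr_gt0// ltr_wpDl.
have [dl dl0 unif] := path_unif_continuous T cay e'0.
have [M M0 aM] := path_bounded T ca.
near=> K; set h := T / (2 ^ K)%:R.
have h0 : 0 <= h by exact: divr_ge0.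
have hT j : (j <= 2 ^ K)%N -> j%:R * h <= T.
  move=> jK; rewrite /h mulrCA ler_piMr// ler_pdivrMr ?ltr0n ?expn_gt0//.
  by rewrite mul1r ler_nat.
have hdl : h < dl.
  rewrite /h ltr_pdivrMr ?ltr0n ?expn_gt0// mulrC -ltr_pdivrMr//.
  apply: (@lt_trans _ _ K%:R); last by rewrite ltr_nat ltn_expl.
  by near: K; exact: nbhs_infty_gtr.
have hM : M * h <= 1.
  rewrite /h mulrA ler_pdivrMr ?ltr0n ?expn_gt0// mul1r ltW//.
  apply: (@lt_trans _ _ K%:R); last by rewrite ltr_nat ltn_expl.
  by near: K; exact: nbhs_infty_gtr.
pose E := euler h (fun i => a (i%:R * h)) (fun i => m (i.+1%:R * h) - m (i%:R * h)) (y 0).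
have err j : (j <= 2 ^ K)%N -> `|y (j%:R * h) - E j| <= j%:R * h * (e / (T + 1)).
  elim: j => [_|j IH jK]; first by rewrite !mul0r /E /= subrr normr0.
  have jh0 : 0 <= j%:R * h by rewrite mulr_ge0.
  have jhT : j%:R * h <= T by apply: hT; exact: ltnW.
  have stepE : j.+1%:R * h - j%:R * h = h by rewrite -natr1; ring.
  have loc : `|\int[mu]_(x in `[0, j.+1%:R * h]) (- a x * y x) -
       \int[mu]_(x in `[0, j%:R * h]) (- a x * y x) -
       (- a (j%:R * h) * y (j%:R * h)) * (j.+1%:R * h - j%:R * h)| <=
       (e / (T + 1)) * (j.+1%:R * h - j%:R * h).
    apply: Rintegral_left_point => //; first by rewrite -subr_ge0 stepE.
    move=> x /andP[jx xj]; apply: unif; rewrite ?jh0 ?(le_trans jh0)//.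
    by apply: le_lt_trans hdl; rewrite ger0_norm ?subr_ge0//; have := stepE; lra.
  rewrite stepE in loc.
  have := eqn K _ jK; have := eqn K _ (ltnW jK); rewrite /= -/h => eqj eqSj.
  have aj : 0 <= 1 - a (j%:R * h) * h <= 1.
    rewrite lerBlDr lerDl mulr_ge0 ?a0// andbT subr_ge0 (le_trans _ hM)//.
    rewrite ler_wpM2r// (le_trans (ler_norm _))// aM//.
    by rewrite jh0 jhT.
  rewrite [X in `|X|](_ : _ = (1 - a (j%:R * h) * h) * (y (j%:R * h) - E j) +
      (\int[mu]_(x in `[0, j.+1%:R * h]) (- a x * y x) -
       \int[mu]_(x in `[0, j%:R * h]) (- a x * y x) -
       - a (j%:R * h) * y (j%:R * h) * h)); last first.
    have -> : E j.+1 = (1 - a (j%:R * h) * h) * E j +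
      (m (j.+1%:R * h) - m (j%:R * h)) by [].
    rewrite {1}eqSj.
    set I1 := \int[mu]_(x in _) _; set I2 := \int[mu]_(x in _) _.
    have -> : y 0 = y (j%:R * h) - I2 - m (j%:R * h) by rewrite eqj -/I2; ring.
    by ring.
  apply: le_trans (ler_normD _ _) _.
  rewrite [leRHS](_ : _ = j%:R * h * (e / (T + 1)) + h * (e / (T + 1))); last first.
    by rewrite -natr1; ring.
  apply: lerD.
    rewrite normrM; apply: le_trans (IH (ltnW jK)).
    by case/andP: aj => aj0 aj1; rewrite ler_piMl// ger0_norm.
  by rewrite [leRHS]mulrC.
have TE : (2 ^ K)%:R * h = T.
  by rewrite /h mulrC divfK// pnatr_eq0 -lt0n expn_gt0.
have := err _ (leqnn _); rewrite TE => /le_trans; apply.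
rewrite mulrCA ler_piMr ?(ltW e0)// ler_pdivrMr ?ltr_wpDl//.
by rewrite mul1r lerDl.
Unshelve. all: by end_near. Qed.

End euler_scheme.

(** * The space of driving noises *)

Section noise_space.
Variable R : realType.

Inductive component := Texture | RealPart | ImagPart.

(** For each component, the initial value sits at [None] and the position of
    the Brownian motion at time [t] at [Some t]. *)
Definition noise := component -> option R -> R.

(** On a grid of step [h], these are independent with known Gaussian laws; the
    index [0] is the initial value, so the increments are shifted by one. *)
Definition piece (h : R) (c : component) (j : nat) (e : noise) : R :=
  if j is i.+1 then e c (Some (i.+1%:R * h)) - e c (Some (i%:R * h))
  else e c None.

Definition noise_box (h : R) (m : nat) (B : nat -> component -> set R) : set noise :=
  [set e | forall j c, (j < m)%N -> B j c (piece h c j e)].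

Definition noise_boxes (h : R) : set (set noise) :=
  [set X | exists m B, (forall j c, measurable (B j c : set R)) /\
                       X = noise_box h m B].

Lemma noise_boxes_setI h : setI_closed (noise_boxes h).
Proof.
move=> _ _ [m [B [mB ->]]] [m' [B' [mB' ->]]].
exists (maxn m m'), (fun j c => (if (j < m)%N then B j c else setT) `&`
  (if (j < m')%N then B' j c else setT)); split.
  by move=> j c; apply: measurableI; case: ifP.
apply/seteqP; split => e /=.
  by move=> [eB eB'] j c _; split; case: ifP => // jm; [exact: eB|exact: eB'].
move=> eBB; split=> j c jm; have := eBB j c; rewrite leq_max jm ?orbT => /(_ isT)[//].
Qed.

Lemma noise_boxes_setT h : noise_boxes h setT.
Proof.
exists 0%N, (fun _ _ => setT); split => //.
by apply/seteqP; split.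
Qed.

Local Notation box_sigma h := (g_sigma_algebraType (noise_boxes h)).

Lemma piece_measurable_box h c j :
  measurable_fun [set: box_sigma h] (piece h c j : box_sigma h -> R).
Proof.
move=> _ B mB; rewrite setTI; apply: sub_sigma_algebra.
exists j.+1, (fun j' c' => if (j' == j) && `[<c' = c>] then B else setT).
split; first by move=> j' c'; case: ifP.
apply/seteqP; split => e /=.
  move=> eB j' c' _; case: ifP => // /andP[/eqP -> /asboolP ->]; exact: eB.
move=> /(_ j c (ltnSn j)); rewrite eqxx/=.
by case: asboolP.
Qed.

Variable tau : R.
Let h N : R := tau / (2 ^ N)%:R.

(** The grids are nested, so this union is stable under intersection; it carries
    the increments between any two dyadic multiples of [tau]. *)
Definition dyadic_events : set (set noise) :=
  \bigcup_N <<s noise_boxes (h N) >>.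
Local Notation E := (g_sigma_algebraType dyadic_events).

Let h2 N i : i%:R * h N = (i * 2)%:R * h N.+1.
Proof.
rewrite /h expnS natrM [in RHS]natrM; have : (2 ^ N)%:R != 0 :> R.
  by rewrite pnatr_eq0 -lt0n expn_gt0.
by move=> ?; field.
Qed.

(** A coarse increment is the sum of two increments of the halved grid. *)
Lemma piece_measurable_halving N c j :
  measurable_fun [set: box_sigma (h N.+1)] (piece (h N) c j : box_sigma (h N.+1) -> R).
Proof.
case: j => [|j]; first exact: (@piece_measurable_box (h N.+1) c 0).
rewrite (_ : piece _ _ _ = fun e => piece (h N.+1) c (j * 2).+2 e +
    piece (h N.+1) c (j * 2).+1 e); last first.
  by apply/funext => e; rewrite /piece subrKA !(h2 N) mulSn.
by apply: measurable_funD; exact: piece_measurable_box.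
Qed.

Lemma box_sigma_halving N :
  <<s noise_boxes (h N) >> `<=` <<s noise_boxes (h N.+1) >>.
Proof.
apply: smallest_sub; first exact: smallest_sigma_algebra.
move=> _ [m [B [mB ->]]].
have slot j c : <<s noise_boxes (h N.+1) >> (piece (h N) c j @^-1` B j c).
  by have := @piece_measurable_halving N c j measurableT _ (mB j c); rewrite setTI.
rewrite (_ : noise_box _ _ _ = \bigcap_(j in `I_m)
   (piece (h N) Texture j @^-1` B j Texture `&`
    piece (h N) RealPart j @^-1` B j RealPart `&`
    piece (h N) ImagPart j @^-1` B j ImagPart)); last first.
  apply/seteqP; split => e /=.
    by move=> eB j jm; split; [split|]; apply: eB.
  by move=> eB j c jm; have [[]] := eB j jm; case: c.
apply: (@bigcap_measurableType _ (box_sigma (h N.+1))) => j _.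
apply: (@measurableI _ (box_sigma (h N.+1))).
  by apply: (@measurableI _ (box_sigma (h N.+1))); exact: slot.
exact: slot.
Qed.

Lemma box_sigma_le N N' : (N <= N')%N ->
  <<s noise_boxes (h N) >> `<=` <<s noise_boxes (h N') >>.
Proof.
move=> /subnK <-; elim: (N' - N)%N => [//|k IH].
by rewrite addSn; apply: subset_trans IH _; exact: box_sigma_halving.
Qed.

Lemma dyadic_events_setI : setI_closed dyadic_events.
Proof.
move=> X Y [N _ XN] [M _ YM]; exists (maxn N M) => //.
apply: (@measurableI _ (box_sigma (h (maxn N M)))).
- by apply: box_sigma_le XN; exact: leq_maxl.
- by apply: box_sigma_le YM; exact: leq_maxr.
Qed.

Lemma piece_measurable N c j : measurable_fun [set: E] (piece (h N) c j : E -> R).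
Proof.
move=> _ B mB; rewrite setTI; apply: sub_sigma_algebra; exists N => //.
by have := @piece_measurable_box (h N) c j measurableT B mB; rewrite setTI.
Qed.

Lemma increment_measurable N c i j :
  measurable_fun [set: E]
    ((fun e => e c (Some (j%:R * h N)) - e c (Some (i%:R * h N))) : E -> R).
Proof.
have from0 k : measurable_fun [set: E]
    ((fun e => e c (Some (k%:R * h N)) - e c (Some (0%:R * h N))) : E -> R).
  elim: k => [|k IH].
    rewrite (_ : (fun _ => _) = cst 0)//; apply/funext => e; exact: subrr.
  rewrite (_ : (fun _ => _) = fun e => piece (h N) c k.+1 e +
      (e c (Some (k%:R * h N)) - e c (Some (0%:R * h N)))); last first.
    by apply/funext => e; rewrite /piece subrKA.
  by apply: measurable_funD => //; exact: piece_measurable.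
rewrite (_ : (fun _ => _) = fun e : noise =>
   (e c (Some (j%:R * h N)) - e c (Some (0%:R * h N))) -
   (e c (Some (i%:R * h N)) - e c (Some (0%:R * h N)))).
  exact: measurable_funB.
by apply/funext => e; rewrite opprB subrKA.
Qed.

End noise_space.

(** * The law of the driving noise *)

Section driving_noise.
Context d (Omega : measurableType d) (R : realType) (P : probability Omega R).
Variables (F : R -> set (set Omega)) (W X : component -> R -> Omega -> R)
  (s1 s2 s3 : R).

Definition driving_noise (w : Omega) : noise R :=
  fun c o => if o is Some t then W c t w else X c 0 w.

Definition noise_model := [/\ filtration F,
  forall c, measurable_wrt (F 0) (X c 0),
  forall c t, 0 <= t -> measurable_wrt (F t) (W c t),
  indep_centred_gaussians P [set setT] (X Texture 0) (X RealPart 0) (X ImagPart 0)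
    s1 s2 s3 &
  forall s t, 0 <= s -> s < t -> indep_centred_gaussians P (F s)
    (fun w => W Texture t w - W Texture s w)
    (fun w => W RealPart t w - W RealPart s w)
    (fun w => W ImagPart t w - W ImagPart s w)
    (Num.sqrt (t - s)) (Num.sqrt (t - s)) (Num.sqrt (t - s))].

Hypothesis hN : noise_model.

Lemma measurable_piece h c j : 0 <= h ->
  measurable_wrt (F (j%:R * h)) (fun w => piece h c j (driving_noise w)).
Proof.
move=> h0; have [[sF Fm Fle] aX aW _ _] := hN.
have jh i : 0 <= i%:R * h by rewrite mulr_ge0.
case: j => [|j]; first by rewrite mul0r; exact: aX.
apply/(measurable_wrtP (sF _ (jh _))); apply: measurable_funB.
  by apply/(measurable_wrtP (sF _ (jh _))); exact: aW.
apply/(measurable_wrtP (sF _ (jh _))) => B mB.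
by apply: (Fle (j%:R * h)) => //; [rewrite ler_wpM2r// ler_nat|exact: aW].
Qed.

Lemma noise_box_recr h m B : driving_noise @^-1` noise_box h m.+1 B =
  driving_noise @^-1` noise_box h m B `&`
  ((fun w => piece h Texture m (driving_noise w)) @^-1` B m Texture `&`
   (fun w => piece h RealPart m (driving_noise w)) @^-1` B m RealPart `&`
   (fun w => piece h ImagPart m (driving_noise w)) @^-1` B m ImagPart).
Proof.
apply/seteqP; split => w /=.
  move=> wB; split; first by move=> j c jm; apply: wB; exact: ltnW.
  by split; [split|]; exact: wB.
move=> [wB [[w1 w2] w3]] j c; rewrite ltnS leq_eqVlt => /predU1P[->|]; last exact: wB.
by case: c.
Qed.

Lemma noise_box0 h B : driving_noise @^-1` noise_box h 0 B = setT.
Proof. by apply/seteqP; split. Qed.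

Lemma noise_box_adapted h m k B : 0 <= h -> (m <= k.+1)%N ->
  (forall j c, measurable (B j c)) ->
  F (k%:R * h) (driving_noise @^-1` noise_box h m B).
Proof.
move=> h0 mk mB; have [[sF Fm Fle] _ _ _ _] := hN.
have kh : 0 <= k%:R * h by rewrite mulr_ge0.
have <- := measurable_g_measurableTypeE (sF _ kh).
elim: m mk => [_|m IH mk]; first by rewrite noise_box0; exact: measurableT.
rewrite noise_box_recr.
have slot c : (F (k%:R * h)).-sigma.-measurable
    ((fun w => piece h c m (driving_noise w)) @^-1` B m c).
  rewrite (measurable_g_measurableTypeE (sF _ kh)).
  apply: (Fle (m%:R * h)); first by rewrite mulr_ge0.
    by rewrite ler_wpM2r// ler_nat.
  exact: measurable_piece.
apply: measurableI; first by apply: IH; exact: ltnW.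
by apply: measurableI => //; exact: measurableI.
Qed.

(** Each time step contributes the law of an increment independent of the past;
    the product no longer mentions the probability space. *)
Lemma noise_box_law h m B : 0 < h -> (forall j c, measurable (B j c)) ->
  P (driving_noise @^-1` noise_box h m B) =
  (\prod_(j < m)
    let sd s := if j : nat is i.+1 then Num.sqrt (i.+1%:R * h - i%:R * h)%R else s in
    normal_prob 0%R (sd s1) (B j Texture) * normal_prob 0%R (sd s2) (B j RealPart) *
    normal_prob 0%R (sd s3) (B j ImagPart))%E.
Proof.
move=> h0 mB; have [[sF Fm Fle] _ _ hinit hincr] := hN.
elim: m => [|m IH]; first by rewrite noise_box0 big_ord0 probability_setT.
rewrite big_ord_recr/= -IH noise_box_recr.
case: m {IH} => [|m].
  by rewrite noise_box0 hinit// probability_setT.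
apply: hincr => //.
- by rewrite mulr_ge0// ltW.
- by rewrite ltr_pM2r// ltr_nat.
- by apply: noise_box_adapted => //; exact: ltW.
Qed.

Variable tau : R.
Hypothesis tau0 : 0 < tau.
Local Notation E := (g_sigma_algebraType (dyadic_events tau)).

Lemma measurable_driving_noise_grid h : 0 <= h -> forall U,
  <<s noise_boxes h >> U -> measurable (driving_noise @^-1` U).
Proof.
move=> h0 U; have [[sF Fm Fle] _ _ _ _] := hN.
have mb : measurable_fun [set: Omega]
    (driving_noise : Omega -> g_sigma_algebraType (noise_boxes h)).
  apply: (@measurability _ _ _ (g_sigma_algebraType (noise_boxes h)) _ _
    (noise_boxes h)) => //.
  move=> _ [_ [m [B [mB ->]]] <-]; rewrite setTI.
  by apply: (Fm (m%:R * h)); [rewrite mulr_ge0|exact: noise_box_adapted].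
by move=> mU; have := mb measurableT U mU; rewrite setTI.
Qed.

Lemma measurable_driving_noise :
  measurable_fun [set: Omega] (driving_noise : Omega -> E).
Proof.
apply: (@measurability _ _ _ E _ _ (dyadic_events tau)) => //.
move=> _ [U [N _ NU] <-]; rewrite setTI.
apply: measurable_driving_noise_grid NU.
by rewrite divr_ge0// ltW.
Qed.

End driving_noise.

Section same_noise_law.
Variables (R : realType) (tau s1 s2 s3 : R).
Hypothesis tau0 : 0 < tau.
Context d1 (O1 : measurableType d1) (P1 : probability O1 R).
Context d2 (O2 : measurableType d2) (P2 : probability O2 R).
Variables (F1 : R -> set (set O1)) (W1 X1 : component -> R -> O1 -> R).
Variables (F2 : R -> set (set O2)) (W2 X2 : component -> R -> O2 -> R).
Hypotheses (hN1 : noise_model P1 F1 W1 X1 s1 s2 s3)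
  (hN2 : noise_model P2 F2 W2 X2 s1 s2 s3).
Local Notation E := (g_sigma_algebraType (dyadic_events tau)).

(** The uniqueness of measures agreeing on a pi-system, used on each grid and
    then on the union of the grids. *)
Lemma same_noise_law (U : set E) : measurable U ->
  P1 (driving_noise W1 X1 @^-1` U) = P2 (driving_noise W2 X2 @^-1` U).
Proof.
have grid h V : 0 < h -> <<s noise_boxes h >> V ->
    P1 (driving_noise W1 X1 @^-1` V) = P2 (driving_noise W2 X2 @^-1` V).
  move=> h0 mV; pose G := g_sigma_algebraType (noise_boxes h).
  have m1 : measurable_fun [set: O1] (driving_noise W1 X1 : O1 -> G).
    by move=> _ S mS; rewrite setTI; exact: (measurable_driving_noise_grid hN1 (ltW h0)).
  have m2 : measurable_fun [set: O2] (driving_noise W2 X2 : O2 -> G).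
    by move=> _ S mS; rewrite setTI; exact: (measurable_driving_noise_grid hN2 (ltW h0)).
  pose b1 : {mfun O1 >-> G} := mfun_Sub (mem_set m1).
  pose b2 : {mfun O2 >-> G} := mfun_Sub (mem_set m2).
  apply: (@measure_unique _ R G (noise_boxes h) (fun=> setT) _ _ _ _
    (distribution P1 b1) (distribution P2 b2)) => //.
  - exact: noise_boxes_setI.
  - by move=> _; exact: noise_boxes_setT.
  - by rewrite bigcup_const.
  - move=> _ [m [B [mB ->]]]; rewrite /= /distribution /pushforward /=.
    by rewrite (noise_box_law hN1)// (noise_box_law hN2).
  - by move=> _; apply: le_lt_trans (ltry 1); exact: probability_le1.
pose m1 := measurable_driving_noise hN1 tau0.
pose m2 := measurable_driving_noise hN2 tau0.
pose b1 : {mfun O1 >-> E} := mfun_Sub (mem_set m1).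
pose b2 : {mfun O2 >-> E} := mfun_Sub (mem_set m2).
apply: (@measure_unique _ R E (dyadic_events tau) (fun=> setT) _ _ _ _
  (distribution P1 b1) (distribution P2 b2)) => //.
- exact: dyadic_events_setI.
- by move=> _; exists 0%N => //; exact: sub_sigma_algebra (noise_boxes_setT _).
- by rewrite bigcup_const.
- move=> V [N _ NV]; apply: grid NV.
  by rewrite divr_gt0// ltr0n expn_gt0.
- by move=> _; apply: le_lt_trans (ltry 1); exact: probability_le1.
Qed.

End same_noise_law.

(** * Common functionals of two noises *)

Section fast_convergence.
Context d (Omega : measurableType d) (R : realType) (P : probability Omega R).

(** The Borel-Cantelli lemma: convergence in probability at a summable rate
    is almost sure. *)
Lemma fast_cvg_ae (Y : nat -> Omega -> R) (X : Omega -> R) :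
  (forall k, measurable_fun setT (Y k)) -> measurable_fun setT X ->
  (forall k, (P [set w | ((2 ^ k.+1)%:R^-1 <= `|Y k w - X w|)%R] <=
     ((2 ^ k.+1)%:R^-1)%:E)%E) ->
  {ae P, forall w, Y k w @[k --> \oo] --> X w}.
Proof.
move=> mY mX fast; pose E k := [set w | (2 ^ k.+1)%:R^-1 <= `|Y k w - X w|].
have mE k : measurable (E k) by exact: measurable_dist_ge.
have limE : P (lim_sup_set E) = 0%E.
  apply: lim_sup_set_cvg0 => //.
  apply: le_lt_trans (ltry 1); apply: le_trans (epsilon_trick0 xpredT ler01).
  by apply: lee_nneseries => // k _; rewrite div1r; exact: fast.
exists (lim_sup_set E); split => //.
  by apply: bigcap_measurable => // k _; exact: bigcup_measurable.
move=> w /=; apply: contra_notP => wE.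
have [N wEN] : exists N, forall k, (N <= k)%N -> ~ E k w.
  apply: contrapT => /forallNP noN; apply: wE => N _.
  by have /existsNP[k /not_implyP[Nk /contrapT Ekw]] := noN N; exists k.
apply/cvgrPdist_lt => e e0; near=> k.
have /wEN : (N <= k)%N by near: k; exact: nbhs_infty_ge.
rewrite /E /= => /negP; rewrite -ltNge distrC => /lt_trans; apply.
rewrite invf_plt ?posrE ?ltr0n ?expn_gt0//; apply: (@lt_trans _ _ k%:R).
  by near: k; exact: nbhs_infty_gtr.
by rewrite ltr_nat (leq_trans (ltn_expl k (ltnSn 1)))// leq_exp2l.
Unshelve. all: by end_near. Qed.

Lemma ae_iff_measure (A B : set Omega) : measurable A -> measurable B ->
  {ae P, forall w, A w <-> B w} -> P A = P B.
Proof.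
move=> + + [N [mN N0 ABN]]; have ABN' w : ~ N w -> (A w <-> B w).
  by move=> Nw; apply: contrapT => AB; apply: Nw; exact: ABN.
wlog suff : A B {ABN} ABN' / measurable A -> measurable B -> (P A <= P B)%E.
  move=> le_of mA mB; apply/eqP; rewrite eq_le !le_of// => w /ABN'[]; by split.
move=> mA mB; rewrite -[leRHS]adde0 -N0.
apply: (le_trans _ (measureU2 P mB mN)).
apply: le_measure; rewrite ?inE//; first exact: measurableU.
move=> w Aw; have [Nw|/ABN'[AB _]] := pselect (N w); first by right.
by left; exact: AB.
Qed.

End fast_convergence.

Section coded_pairs.
Context dE (E : measurableType dE) (R : realType).
Context d1 (O1 : measurableType d1) (P1 : probability O1 R) (b1 : O1 -> E).
Context d2 (O2 : measurableType d2) (P2 : probability O2 R) (b2 : O2 -> E).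

(** Random variables on two spaces that are the same functional of two noises
    with equal law have equal laws, also jointly.  This notion replaces equality
    of joint laws because it is closed under operations taken one random
    variable at a time. *)
Definition coded (X1 : O1 -> R) (X2 : O2 -> R) := exists phi : E -> R,
  [/\ measurable_fun setT phi, {ae P1, forall w, X1 w = phi (b1 w)} &
      {ae P2, forall w, X2 w = phi (b2 w)}].

Lemma coded_base (phi : E -> R) : measurable_fun setT phi ->
  coded (fun w => phi (b1 w)) (fun w => phi (b2 w)).
Proof. by move=> mphi; exists phi; split => //; exact: aeW. Qed.

Lemma coded_comp (h : R -> R) X1 X2 : measurable_fun setT h -> coded X1 X2 ->
  coded (fun w => h (X1 w)) (fun w => h (X2 w)).
Proof.
move=> mh [phi [mphi e1 e2]]; exists (fun e => h (phi e)); split.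
- exact: measurableT_comp.
- by apply: filterS e1 => w ->.
- by apply: filterS e2 => w ->.
Qed.

Lemma coded_cst r : coded (cst r) (cst r).
Proof. exact: (@coded_base (cst r)). Qed.

Lemma codedD X1 X2 Y1 Y2 : coded X1 X2 -> coded Y1 Y2 ->
  coded (fun w => X1 w + Y1 w) (fun w => X2 w + Y2 w).
Proof.
move=> [phi [mphi e1 e2]] [psi [mpsi f1 f2]].
exists (fun e => phi e + psi e); split; first exact: measurable_funD.
- by apply: filterS2 e1 f1 => w -> ->.
- by apply: filterS2 e2 f2 => w -> ->.
Qed.

Lemma codedM X1 X2 Y1 Y2 : coded X1 X2 -> coded Y1 Y2 ->
  coded (fun w => X1 w * Y1 w) (fun w => X2 w * Y2 w).
Proof.
move=> [phi [mphi e1 e2]] [psi [mpsi f1 f2]].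
exists (fun e => phi e * psi e); split; first exact: measurable_funM.
- by apply: filterS2 e1 f1 => w -> ->.
- by apply: filterS2 e2 f2 => w -> ->.
Qed.

Lemma codedB X1 X2 Y1 Y2 : coded X1 X2 -> coded Y1 Y2 ->
  coded (fun w => X1 w - Y1 w) (fun w => X2 w - Y2 w).
Proof.
move=> [phi [mphi e1 e2]] [psi [mpsi f1 f2]].
exists (fun e => phi e - psi e); split; first exact: measurable_funB.
- by apply: filterS2 e1 f1 => w -> ->.
- by apply: filterS2 e2 f2 => w -> ->.
Qed.

Lemma coded_sum n (X1 : nat -> O1 -> R) (X2 : nat -> O2 -> R) :
  (forall i, (i < n)%N -> coded (X1 i) (X2 i)) ->
  coded (fun w => \sum_(i < n) X1 i w) (fun w => \sum_(i < n) X2 i w).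
Proof.
elim: n => [_|n IH X].
  rewrite (_ : (fun _ => _) = cst 0); last by apply/funext => w; rewrite big_ord0.
  rewrite (_ : (fun _ : O2 => _) = cst 0); last by apply/funext => w; rewrite big_ord0.
  exact: coded_cst.
rewrite (_ : (fun _ => _) = fun w => \sum_(i < n) X1 i w + X1 n w); last first.
  by apply/funext => w; rewrite big_ord_recr.
rewrite (_ : (fun _ : O2 => _) = fun w => \sum_(i < n) X2 i w + X2 n w); last first.
  by apply/funext => w; rewrite big_ord_recr.
by apply: codedD (X n (ltnSn n)); apply: IH => i il; exact: X (ltnW il).
Qed.

(** The upper limit of the functionals is a measurable choice of a limit. *)
Lemma coded_ae_lim (X1 : nat -> O1 -> R) (X2 : nat -> O2 -> R) Y1 Y2 :
  (forall n, coded (X1 n) (X2 n)) ->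
  {ae P1, forall w, X1 n w @[n --> \oo] --> Y1 w} ->
  {ae P2, forall w, X2 n w @[n --> \oo] --> Y2 w} -> coded Y1 Y2.
Proof.
move=> /choice[phi hphi] c1 c2.
pose L e := limn_esup (fun n => (phi n e)%:E).
have mL : measurable_fun setT L.
  apply: measurable_fun_limn_esup => n; apply/measurable_EFinP.
  by have [] := hphi n.
have LE e y : phi n e @[n --> \oo] --> y -> fine (L e) = y.
  move=> phiy; have phiy' : (phi n e)%:E @[n --> \oo] --> y%:E.
    by apply: cvg_EFin => //; exact: nearW.
  rewrite /L is_cvg_limn_esupE; last by apply/cvg_ex; exists y%:E.
  by rewrite (cvg_lim _ phiy').
exists (fun e => fine (L e)); split.
- exact: (measurableT_comp (fine_measurable measurableT) mL).
- have : {ae P1, forall w, forall n, X1 n w = phi n (b1 w)}.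
    by apply: ae_foralln => n; have [] := hphi n.
  move=> ae1; apply: filterS2 c1 ae1 => w + e; rewrite (_ : X1 ^~ w = phi ^~ (b1 w)).
    by move=> /LE ->.
  by apply/funext => n; exact: e.
- have : {ae P2, forall w, forall n, X2 n w = phi n (b2 w)}.
    by apply: ae_foralln => n; have [] := hphi n.
  move=> ae2; apply: filterS2 c2 ae2 => w + e; rewrite (_ : X2 ^~ w = phi ^~ (b2 w)).
    by move=> /LE ->.
  by apply/funext => n; exact: e.
Qed.

(** A rate good for both probabilities can be read off along a subsequence. *)
Lemma coded_probability_lim (X1 : nat -> O1 -> R) (X2 : nat -> O2 -> R) Y1 Y2 :
  (forall n, coded (X1 n) (X2 n)) ->
  cvg_in_probability P1 X1 Y1 -> cvg_in_probability P2 X2 Y2 -> coded Y1 Y2.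
Proof.
move=> cX [mX1 mY1 c1] [mX2 mY2 c2].
have : forall k, exists n,
    (P1 [set w | ((2 ^ k.+1)%:R^-1 <= `|X1 n w - Y1 w|)%R] <= ((2 ^ k.+1)%:R^-1)%:E)%E /\
    (P2 [set w | ((2 ^ k.+1)%:R^-1 <= `|X2 n w - Y2 w|)%R] <= ((2 ^ k.+1)%:R^-1)%:E)%E.
  move=> k; have e0 : 0 < (2 ^ k.+1)%:R^-1 :> R by rewrite invr_gt0 ltr0n expn_gt0.
  have /cvg_probability0P/(_ _ e0) := c1 _ e0.
  have /cvg_probability0P/(_ _ e0) := c2 _ e0.
  by move=> n2 n1; have [n [h1 h2]] := filter_ex (filterI n1 n2); exists n.
move=> /choice[n hn].
apply: (@coded_ae_lim (fun k => X1 (n k)) (fun k => X2 (n k))) => //.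
- by apply: fast_cvg_ae => // k; have [] := hn k.
- by apply: fast_cvg_ae => // k; have [] := hn k.
Qed.

Hypotheses (mb1 : measurable_fun setT b1) (mb2 : measurable_fun setT b2)
  (same_law : forall U, measurable U -> P1 (b1 @^-1` U) = P2 (b2 @^-1` U)).

Lemma coded_same_law n (X1 Y1 : 'I_n -> O1 -> R) (X2 Y2 : 'I_n -> O2 -> R) :
  (forall i, coded (X1 i) (X2 i)) -> (forall i, coded (Y1 i) (Y2 i)) ->
  (forall i, measurable_fun setT (X1 i)) -> (forall i, measurable_fun setT (X2 i)) ->
  (forall i, measurable_fun setT (Y1 i)) -> (forall i, measurable_fun setT (Y2 i)) ->
  forall U : set (n.-tuple (R * R)), measurable U ->
  P1 [set w | U [tuple (X1 i w, Y1 i w) | i < n]] =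
  P2 [set w | U [tuple (X2 i w, Y2 i w) | i < n]].
Proof.
move=> /choice[phi hphi] /choice[psi hpsi] mX1 mX2 mY1 mY2 U mU.
have mtuple d (T : measurableType d) (f g : 'I_n -> T -> R) :
    (forall i, measurable_fun setT (f i)) -> (forall i, measurable_fun setT (g i)) ->
    measurable_fun setT (fun w => [tuple (f i w, g i w) | i < n]).
  move=> mf mg; apply/measurable_fun_tnthP => i.
  rewrite (_ : _ \o _ = fun w => (f i w, g i w)).
    exact: measurable_fun_pair.
  by apply/funext => w /=; rewrite tnth_mktuple.
have mpre d (T : measurableType d) (f : T -> n.-tuple (R * R)) :
    measurable_fun setT f -> measurable [set w | U (f w)].
  by move=> mf; rewrite -[X in measurable X]setTI; exact: mf.
pose V := [set e | U [tuple (phi i e, psi i e) | i < n]].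
have mV : measurable V.
  apply: mpre; apply: mtuple => i; [by have [] := hphi i|by have [] := hpsi i].
have ae_ord d (T : measurableType d) (P : probability T R) (Q : 'I_n -> T -> Prop) :
    (forall i, {ae P, forall w, Q i w}) -> {ae P, forall w, forall i, Q i w}.
  exact: filter_forall.
have ae1 : {ae P1, forall w, forall i, X1 i w = phi i (b1 w) /\ Y1 i w = psi i (b1 w)}.
  apply: ae_ord => i; have [_ e1 _] := hphi i; have [_ f1 _] := hpsi i.
  by apply: filterS2 e1 f1 => w -> ->.
have ae2 : {ae P2, forall w, forall i, X2 i w = phi i (b2 w) /\ Y2 i w = psi i (b2 w)}.
  apply: ae_ord => i; have [_ _ e1] := hphi i; have [_ _ f1] := hpsi i.
  by apply: filterS2 e1 f1 => w -> ->.
transitivity (P1 (b1 @^-1` V)).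
  apply: ae_iff_measure.
  - by apply: mpre; exact: mtuple.
  - by rewrite -[X in measurable X]setTI; exact: mb1.
  apply: filterS ae1 => w e1; rewrite /V /=.
  by rewrite (_ : [tuple (X1 i w, Y1 i w) | i < n] =
    [tuple (phi i (b1 w), psi i (b1 w)) | i < n])//;
    apply: eq_from_tnth => i; rewrite !tnth_mktuple; have [-> ->] := e1 i.
rewrite same_law//; symmetry; apply: ae_iff_measure.
- by apply: mpre; exact: mtuple.
- by rewrite -[X in measurable X]setTI; exact: mb2.
apply: filterS ae2 => w e2; rewrite /V /=.
by rewrite (_ : [tuple (X2 i w, Y2 i w) | i < n] =
  [tuple (phi i (b2 w), psi i (b2 w)) | i < n])//;
  apply: eq_from_tnth => i; rewrite !tnth_mktuple; have [-> ->] := e2 i.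
Qed.

End coded_pairs.

(** * Linear stochastic differential equations *)

Section linear_sde.
Context d (Omega : measurableType d) (R : realType) (P : probability Omega R).
Variables (F : R -> set (set Omega)) (W y a sigma : R -> Omega -> R).
Hypotheses (cy : forall w, {within `[0, +oo[, continuous (fun t => y t w)})
  (ca : forall w, {within `[0, +oo[, continuous (fun t => a t w)})
  (a0 : forall t w, 0 <= t -> 0 <= a t w).

(** Pathwise in the Ito integral [M], the equation is an ordinary linear
    equation, which the Euler scheme solves. *)
Lemma linear_sde_euler :
  solves_sde P F W y (fun t w => - a t w * y t w) sigma ->
  exists M : R -> Omega -> R,
    (forall t, 0 <= t -> is_ito_integral P F W sigma t (M t)) /\
    forall T, 0 <= T -> {ae P, forall w,
      euler (T / (2 ^ K)%:R) (fun i => a (i%:R * (T / (2 ^ K)%:R)) w)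
        (fun i => M (i.+1%:R * (T / (2 ^ K)%:R)) w - M (i%:R * (T / (2 ^ K)%:R)) w)
        (y 0 w) (2 ^ K) @[K --> \oo] --> y T w}.
Proof.
move=> sde.
have /choice[M hM] : forall t, exists M : Omega -> R, 0 <= t ->
    is_ito_integral P F W sigma t M /\ {ae P, forall w,
      y t w = y 0 w + \int[lebesgue_measure]_(s in `[0, t]) (- a s w * y s w) + M w}.
  move=> t; have [t0|_] := leP 0 t; last by exists (cst 0).
  by have [M hM] := sde t t0; exists M.
exists M; split; first by move=> t /hM[].
move=> T T0.
have : {ae P, forall w, forall K, forall j, (fun t =>
    y t w = y 0 w + \int[lebesgue_measure]_(s in `[0, t]) (- a s w * y s w) + M t w)
    (j%:R * (T / (2 ^ K)%:R))}.
  apply: ae_foralln => K; apply: ae_foralln => j.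
  by have [|_ ] := hM (j%:R * (T / (2 ^ K)%:R)); first by rewrite mulr_ge0// divr_ge0.
apply: filterS => w eqn.
apply: (@euler_cvg R (fun t => y t w) (fun t => a t w) (fun t => M t w)) => //.
- by move=> x x0; exact: a0.
- by move=> K j _; exact: eqn.
Qed.

End linear_sde.

Section coded_linear_sde.
Variables (R : realType) (tau : R).
Hypothesis tau0 : 0 <= tau.
Context dE (E : measurableType dE).
Context d1 (O1 : measurableType d1) (P1 : probability O1 R) (b1 : O1 -> E).
Context d2 (O2 : measurableType d2) (P2 : probability O2 R) (b2 : O2 -> E).
Local Notation coded := (coded P1 b1 P2 b2).

Lemma coded_euler h n (a1 dm1 : nat -> O1 -> R) (a2 dm2 : nat -> O2 -> R) y1 y2 :
  (forall i, coded (a1 i) (a2 i)) -> (forall i, coded (dm1 i) (dm2 i)) ->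
  coded y1 y2 ->
  coded (fun w => euler h (a1 ^~ w) (dm1 ^~ w) (y1 w) n)
        (fun w => euler h (a2 ^~ w) (dm2 ^~ w) (y2 w) n).
Proof.
move=> ha hdm hy; elim: n => [//|n IH] /=.
apply: codedD (hdm n); apply: codedM IH; apply: codedB; first exact: coded_cst.
by apply: codedM => //; exact: coded_cst.
Qed.

Let dyadic (N p : nat) : R := p%:R * (tau / (2 ^ N)%:R).

Let dyadic_ge0 N p : 0 <= dyadic N p.
Proof. by rewrite mulr_ge0// divr_ge0. Qed.

Let dyadic_sub N p K i : i%:R * (dyadic N p / (2 ^ K)%:R) = dyadic (N + K) (i * p).
Proof.
rewrite /dyadic expnD !natrM invfM; ring.
Qed.

Variables (F1 : R -> set (set O1)) (W1 y1 a1 sg1 : R -> O1 -> R).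
Variables (F2 : R -> set (set O2)) (W2 y2 a2 sg2 : R -> O2 -> R).
Hypotheses (hF1 : filtration F1) (hF2 : filtration F2)
  (hW1 : gaussian_increments P1 F1 W1) (hW2 : gaussian_increments P2 F2 W2)
  (cy1 : forall w, {within `[0, +oo[, continuous (fun t => y1 t w)})
  (cy2 : forall w, {within `[0, +oo[, continuous (fun t => y2 t w)})
  (ca1 : forall w, {within `[0, +oo[, continuous (fun t => a1 t w)})
  (ca2 : forall w, {within `[0, +oo[, continuous (fun t => a2 t w)})
  (a10 : forall t w, 0 <= t -> 0 <= a1 t w)
  (a20 : forall t w, 0 <= t -> 0 <= a2 t w)
  (csg1 : continuous_adapted F1 sg1) (csg2 : continuous_adapted F2 sg2)
  (sde1 : solves_sde P1 F1 W1 y1 (fun t w => - a1 t w * y1 t w) sg1)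
  (sde2 : solves_sde P2 F2 W2 y2 (fun t w => - a2 t w * y2 t w) sg2)
  (hW : forall N i j, coded (fun w => W1 (dyadic N j) w - W1 (dyadic N i) w)
                            (fun w => W2 (dyadic N j) w - W2 (dyadic N i) w))
  (hy0 : coded (y1 0) (y2 0))
  (ha : forall N i, coded (a1 (dyadic N i)) (a2 (dyadic N i)))
  (hsg : forall N i, coded (sg1 (dyadic N i)) (sg2 (dyadic N i))).

(** The solution is reached by two successive limits of explicit functionals:
    left-point sums for the Ito integral, then the Euler scheme driven by it.
    Taking one limit inside the other avoids uniform estimates. *)
Lemma coded_linear_sde N p : coded (y1 (dyadic N p)) (y2 (dyadic N p)).
Proof.
have [M1 [ito1 cvg1]] := linear_sde_euler cy1 ca1 a10 sde1.
have [M2 [ito2 cvg2]] := linear_sde_euler cy2 ca2 a20 sde2.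
have hM N' i : coded (M1 (dyadic N' i)) (M2 (dyadic N' i)).
  have c1 := ito_integral_left_sums hF1 hW1 csg1 (dyadic_ge0 N' i) (ito1 _ (dyadic_ge0 N' i)).
  have c2 := ito_integral_left_sums hF2 hW2 csg2 (dyadic_ge0 N' i) (ito2 _ (dyadic_ge0 N' i)).
  apply: (coded_probability_lim _ c1 c2) => K.
  pose t l := l%:R * (dyadic N' i / (2 ^ K)%:R).
  have left_sums dO (Omega : measurableType dO) (W sg : R -> Omega -> R) :
      step_integral (left_step sg (dyadic N' i) K) W (dyadic N' i) =
      fun w => \sum_(l < 2 ^ K) sg (t l) w * (W (t l.+1) w - W (t l) w).
    by apply/funext => w; rewrite left_step_integral.
  rewrite !left_sums.
  apply: (@coded_sum _ _ _ _ _ _ _ _ _ _ _ (2 ^ K)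
    (fun l w => sg1 (t l) w * (W1 (t l.+1) w - W1 (t l) w))
    (fun l w => sg2 (t l) w * (W2 (t l.+1) w - W2 (t l) w))).
  by move=> l _; rewrite /t !dyadic_sub; exact: codedM.
apply: (coded_ae_lim _ (cvg1 _ (dyadic_ge0 N p)) (cvg2 _ (dyadic_ge0 N p))) => K.
apply: (@coded_euler _ _ (fun i => a1 (i%:R * _))
  (fun i w => M1 (i.+1%:R * _) w - M1 (i%:R * _) w)
  (fun i => a2 (i%:R * _)) (fun i w => M2 (i.+1%:R * _) w - M2 (i%:R * _) w)) => //.
- by move=> i; rewrite !dyadic_sub.
- by move=> i; rewrite !dyadic_sub; exact: codedB.
Qed.

End coded_linear_sde.

(** * Uniqueness in law and symmetry of the texture model *)

Section texture_uniqueness.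
Variable R : realType.

Definition by_component (T : Type) (x y z : T) (c : component) : T :=
  match c with Texture => x | RealPart => y | ImagPart => z end.

Lemma gaussian_increments_bm d (Omega : measurableType d) (P : probability Omega R)
    F (W1 W2 W3 : R -> Omega -> R) : brownian_motion3 P F W1 W2 W3 ->
  [/\ gaussian_increments P F W1, gaussian_increments P F W2 &
      gaussian_increments P F W3].
Proof.
move=> [[aW1 _] [aW2 _] [aW3 _] _ incr].
have NT s : normal_prob 0 s setT = 1%E :> \bar R by exact: probability_setT.
split; split => // s t s0 st C B FC mB.
- have := incr s t s0 st C B setT setT FC mB measurableT measurableT.
  by rewrite !preimage_setT !setIT !NT !mule1.
- have := incr s t s0 st C setT B setT FC measurableT mB measurableT.
  by rewrite !preimage_setT setIT setTI !NT mule1 mul1e.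
- have := incr s t s0 st C setT setT B FC measurableT measurableT mB.
  by rewrite !preimage_setT !setTI !NT !mul1e.
Qed.

Lemma texture_noise_model (A B0 lambda : R) d (Omega : measurableType d)
    (P : probability Omega R) F (Wx WR WI Z gR gI : R -> Omega -> R) :
  texture_model A B0 lambda P F Wx WR WI Z gR gI ->
  noise_model P F (by_component Wx WR WI) (by_component Z gR gI)
    1 (Num.sqrt 2^-1) (Num.sqrt 2^-1).
Proof.
case=> hF [[aWx _] [aWR _] [aWI _] _ incr] [aZ _] [aR _] [aI _] init _ _ _.
split => //.
- by case => /=; [exact: aZ|exact: aR|exact: aI].
- by case => /= t t0; [exact: aWx|exact: aWR|exact: aWI].
Qed.

Lemma continuous_texture_rate (B0 lambda : R) :
  continuous (fun z => texture_rate B0 lambda z / 2).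
Proof.
move=> z; apply: cvgM; last exact: cvg_cst.
apply: cvgM; first exact: cvg_cst.
apply: (@continuous_comp _ _ _ (fun z => lambda * z - lambda ^+ 2 / 2) expR).
  apply: cvgB; last exact: cvg_cst.
  by apply: cvgM; [exact: cvg_cst|exact: cvg_id].
exact: continuous_expR.
Qed.

Lemma texture_rate_ge0 (B0 lambda z : R) : 0 < B0 -> 0 <= texture_rate B0 lambda z / 2.
Proof. by move=> B00; rewrite divr_ge0// mulr_ge0 ?expR_ge0// ltW. Qed.

Lemma continuous_adapted_comp d (Omega : measurableType d) (F : R -> set (set Omega))
    (Y : R -> Omega -> R) (h : R -> R) : filtration F -> continuous_adapted F Y ->
  continuous h -> continuous_adapted F (fun t w => h (Y t w)).
Proof.
move=> [sF _ _] [aY cY] ch; split.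
  move=> t t0; apply/(measurable_wrtP (sF _ t0)).
  apply: measurableT_comp; first exact: continuous_measurable_fun.
  by apply/(measurable_wrtP (sF _ t0)); exact: aY.
by move=> w; exact: path_comp.
Qed.

Section two_models.
Variables (A B0 lambda Dt : R).
Hypotheses (A0 : 0 < A) (B00 : 0 < B0) (Dt0 : 0 < Dt).
Context d1 (O1 : measurableType d1) (P1 : probability O1 R).
Context d2 (O2 : measurableType d2) (P2 : probability O2 R).
Variables (F1 : R -> set (set O1)) (Wx1 WR1 WI1 Z1 gR1 gI1 : R -> O1 -> R).
Variables (F2 : R -> set (set O2)) (Wx2 WR2 WI2 Z2 gR2 gI2 : R -> O2 -> R).
Hypotheses (tm1 : texture_model A B0 lambda P1 F1 Wx1 WR1 WI1 Z1 gR1 gI1)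
  (tm2 : texture_model A B0 lambda P2 F2 Wx2 WR2 WI2 Z2 gR2 gI2).

Let E := g_sigma_algebraType (dyadic_events Dt).
Let W1 := by_component Wx1 WR1 WI1.
Let W2 := by_component Wx2 WR2 WI2.
Let X1 := by_component Z1 gR1 gI1.
Let X2 := by_component Z2 gR2 gI2.
Let b1 : O1 -> E := driving_noise W1 X1.
Let b2 : O2 -> E := driving_noise W2 X2.
Local Notation coded := (coded P1 b1 P2 b2).

Let hF1 := tm_filtration tm1.
Let hF2 := tm_filtration tm2.

Let coded_init c : coded (X1 c 0) (X2 c 0).
Proof.
have := @coded_base _ E R _ _ P1 b1 _ _ P2 b2 _ (@piece_measurable R Dt 0 c 0).
exact.
Qed.

Let coded_increment c N i j :
  coded (fun w => W1 c (j%:R * (Dt / (2 ^ N)%:R)) w - W1 c (i%:R * (Dt / (2 ^ N)%:R)) w)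
        (fun w => W2 c (j%:R * (Dt / (2 ^ N)%:R)) w - W2 c (i%:R * (Dt / (2 ^ N)%:R)) w).
Proof.
have := @coded_base _ E R _ _ P1 b1 _ _ P2 b2 _ (@increment_measurable R Dt N c i j).
exact.
Qed.

Let coded_texture N p :
  coded (Z1 (p%:R * (Dt / (2 ^ N)%:R))) (Z2 (p%:R * (Dt / (2 ^ N)%:R))).
Proof.
have [gW1 _ _] := gaussian_increments_bm (tm_brownian tm1).
have [gW2 _ _] := gaussian_increments_bm (tm_brownian tm2).
have ccst d (O : measurableType d) (F : R -> set (set O)) (r : R) :
    filtration F -> continuous_adapted F (fun _ _ => r).
  move=> [sF _ _]; split; last by move=> w x; exact: cvg_cst.
  move=> t t0; apply/(measurable_wrtP (sF _ t0)); exact: measurable_cst.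
apply: (coded_linear_sde (ltW Dt0) hF1 hF2 gW1 gW2 (tm_adaptedZ tm1).2
  (tm_adaptedZ tm2).2 _ _ _ _ (ccst _ _ _ _ hF1) (ccst _ _ _ _ hF2)
  (tm_sdeZ tm1) (tm_sdeZ tm2)).
- by move=> w x; exact: cvg_cst.
- by move=> w x; exact: cvg_cst.
- by move=> _ _ _; exact: ltW.
- by move=> _ _ _; exact: ltW.
- exact: (coded_increment Texture).
- exact: (coded_init Texture).
- by move=> _ _; exact: coded_cst.
- by move=> _ _; exact: coded_cst.
Qed.

Let coded_quadrature c (g1 : R -> O1 -> R) (g2 : R -> O2 -> R) N p :
  gaussian_increments P1 F1 (W1 c) -> gaussian_increments P2 F2 (W2 c) ->
  continuous_adapted F1 g1 -> continuous_adapted F2 g2 ->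
  solves_sde P1 F1 (W1 c) g1
    (fun t w => - (texture_rate B0 lambda (Z1 t w) / 2) * g1 t w)
    (fun t w => Num.sqrt (texture_rate B0 lambda (Z1 t w) / 2)) ->
  solves_sde P2 F2 (W2 c) g2
    (fun t w => - (texture_rate B0 lambda (Z2 t w) / 2) * g2 t w)
    (fun t w => Num.sqrt (texture_rate B0 lambda (Z2 t w) / 2)) ->
  coded (g1 0) (g2 0) ->
  coded (g1 (p%:R * (Dt / (2 ^ N)%:R))) (g2 (p%:R * (Dt / (2 ^ N)%:R))).
Proof.
move=> gW1 gW2 cg1 cg2 sde1 sde2 hg0.
have crate := @continuous_texture_rate B0 lambda.
have csqrt : continuous (fun z => Num.sqrt (texture_rate B0 lambda z / 2)).
  by move=> z; apply: continuous_comp; [exact: crate|exact: sqrt_continuous].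
apply: (coded_linear_sde (ltW Dt0) hF1 hF2 gW1 gW2 cg1.2 cg2.2 _ _ _ _
  (continuous_adapted_comp hF1 (tm_adaptedZ tm1) csqrt)
  (continuous_adapted_comp hF2 (tm_adaptedZ tm2) csqrt) sde1 sde2).
- by move=> w; apply: path_comp crate; exact: (tm_adaptedZ tm1).2.
- by move=> w; apply: path_comp crate; exact: (tm_adaptedZ tm2).2.
- by move=> *; exact: texture_rate_ge0.
- by move=> *; exact: texture_rate_ge0.
- exact: coded_increment.
- exact: hg0.
- move=> M i; apply: (coded_comp (h := fun z => texture_rate B0 lambda z / 2) _
    (coded_texture M i)); exact: continuous_measurable_fun.
- move=> M i; apply: (coded_comp
    (h := fun z => Num.sqrt (texture_rate B0 lambda z / 2)) _ (coded_texture M i)).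
  exact: continuous_measurable_fun.
Qed.

Lemma texture_observations_same_law n (k : 'I_n -> nat) (U : set (n.-tuple (R * R))) :
  measurable U ->
  P1 [set w | U [tuple (gR1 ((k i)%:R * Dt) w, gI1 ((k i)%:R * Dt) w) | i < n]] =
  P2 [set w | U [tuple (gR2 ((k i)%:R * Dt) w, gI2 ((k i)%:R * Dt) w) | i < n]].
Proof.
have [_ gR1W gI1W] := gaussian_increments_bm (tm_brownian tm1).
have [_ gR2W gI2W] := gaussian_increments_bm (tm_brownian tm2).
have mg d (O : measurableType d) (F : R -> set (set O)) (g : R -> O -> R) (i : nat) :
    filtration F -> continuous_adapted F g -> measurable_fun setT (g (i%:R * Dt)).
  move=> [sF Fm _] [ag _]; have t0 : 0 <= i%:R * Dt by rewrite mulr_ge0// ltW.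
  exact: (measurable_fun_sub (sF _ t0) (Fm _ t0)
    ((measurable_wrtP (sF _ t0) _).1 (ag _ t0))).
have grid i : i%:R * Dt = i%:R * (Dt / (2 ^ 0)%:R) by rewrite expn0 divr1.
move=> mU; apply: (@coded_same_law _ E R _ _ P1 b1 _ _ P2 b2) => //.
- by have := measurable_driving_noise (texture_noise_model tm1) Dt0; exact.
- by have := measurable_driving_noise (texture_noise_model tm2) Dt0; exact.
- move=> V mV.
  by have := same_noise_law Dt0 (texture_noise_model tm1) (texture_noise_model tm2) mV;
    exact.
- move=> i; rewrite grid; apply: (@coded_quadrature RealPart) => //.
  + exact: tm_adaptedR tm1.
  + exact: tm_adaptedR tm2.
  + exact: tm_sdeR tm1.
  + exact: tm_sdeR tm2.
  + exact: (coded_init RealPart).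
- move=> i; rewrite grid; apply: (@coded_quadrature ImagPart) => //.
  + exact: tm_adaptedI tm1.
  + exact: tm_adaptedI tm2.
  + exact: tm_sdeI tm1.
  + exact: tm_sdeI tm2.
  + exact: (coded_init ImagPart).
- by move=> i; apply: mg hF1 (tm_adaptedR tm1).
- by move=> i; apply: mg hF2 (tm_adaptedR tm2).
- by move=> i; apply: mg hF1 (tm_adaptedI tm1).
- by move=> i; apply: mg hF2 (tm_adaptedI tm2).
Qed.

End two_models.

(** The texture has constant coefficients and is coded by the noise first; the
    quadratures, whose coefficients are functions of the texture, follow. *)
Lemma observed_law_unique (A B0 Dt lambda : R) n (k : 'I_n -> nat)
    (Q Q' : probability (n.-tuple (R * R)) R) : 0 < A -> 0 < B0 -> 0 < Dt ->
  is_observed_law A B0 Dt lambda k Q -> is_observed_law A B0 Dt lambda k Q' ->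
  forall U, measurable U -> Q U = Q' U.
Proof.
move=> A0 B00 Dt0.
move=> [d1 [Om1 [P1 [F1 [Wx1 [WR1 [WI1 [Z1 [gR1 [gI1 [tm1 Q1]]]]]]]]]]].
move=> [d2 [Om2 [P2 [F2 [Wx2 [WR2 [WI2 [Z2 [gR2 [gI2 [tm2 Q2]]]]]]]]]]].
move=> U mU; rewrite Q1// Q2//.
exact: (texture_observations_same_law A0 B00 Dt0 tm1 tm2).
Qed.

End texture_uniqueness.

Section sign_symmetry.
Variable R : realType.

Lemma cvg_in_probabilityN d (Omega : measurableType d) (P : probability Omega R)
    (X : nat -> Omega -> R) (Y : Omega -> R) : cvg_in_probability P X Y ->
  cvg_in_probability P (fun n w => - X n w) (fun w => - Y w).
Proof.
move=> [mX mY cXY]; have mN (f : Omega -> R) : measurable_fun setT f ->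
    measurable_fun setT (fun w => - f w).
  by move=> mf; apply: measurableT_comp.
split; [by move=> n; exact: mN|exact: mN|].
move=> e e0; rewrite (_ : (fun n => P _) =
    fun n => P [set w | e <= `|X n w - Y w|]); first exact: cXY.
apply/funext => n; congr (P _); apply/funext => w /=.
by rewrite -opprD normrN.
Qed.

Lemma measurable_opp_preimage (B : set R) : measurable B -> measurable (-%R @^-1` B).
Proof.
move=> mB; rewrite -[X in measurable X]setTI.
by have mo : measurable_fun [set: R] (-%R : R -> R) by []; exact: mo.
Qed.

Lemma continuous_adaptedN d (Omega : measurableType d) (F : R -> set (set Omega))
    (Y : R -> Omega -> R) : continuous_adapted F Y ->
  continuous_adapted F (fun t w => - Y t w).
Proof.
move=> [aY cY]; split; last by move=> w x; apply: continuousN; exact: cY.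
by move=> t t0 B mB; exact: (aY t t0 _ (measurable_opp_preimage mB)).
Qed.

Lemma indep_centred_gaussiansN d (Omega : measurableType d) (P : probability Omega R)
    G (Y1 Y2 Y3 : Omega -> R) s1 s2 s3 : s1 != 0 ->
  indep_centred_gaussians P G Y1 Y2 Y3 s1 s2 s3 ->
  indep_centred_gaussians P G (fun w => - Y1 w) Y2 Y3 s1 s2 s3.
Proof.
move=> s10 h C B1 B2 B3 GC mB1 mB2 mB3.
rewrite -(normal_prob_opp s10 mB1).
exact: (h C _ _ _ GC (measurable_opp_preimage mB1)).
Qed.

Lemma is_ito_integralN d (Omega : measurableType d) (P : probability Omega R) F
    (W H : R -> Omega -> R) T X : is_ito_integral P F W H T X ->
  is_ito_integral P F (fun t w => - W t w) H T (fun w => - X w).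
Proof.
move=> [S [aS cH cI]]; exists S; split => //.
rewrite (_ : (fun n => _) = fun n w => - step_integral (S n) W T w).
  exact: cvg_in_probabilityN.
apply/funext => n; apply/funext => w; rewrite /step_integral -sumrN.
by apply: eq_bigr => i _; rewrite -opprD mulrN.
Qed.

Lemma texture_rateN (B0 lambda z : R) :
  texture_rate B0 (- lambda) (- z) = texture_rate B0 lambda z.
Proof. by rewrite /texture_rate mulrNN sqrrN. Qed.

(** The rate only sees [lambda * Z] and [lambda ^+ 2], and the Ornstein-Uhlenbeck
    texture is symmetric: flipping its sign, and that of its noise, exchanges
    [lambda] and [- lambda] without touching the observed quadratures. *)
Lemma texture_model_opp (A B0 lambda : R) d (Omega : measurableType d)
    (P : probability Omega R) F (Wx WR WI Z gR gI : R -> Omega -> R) :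
  texture_model A B0 lambda P F Wx WR WI Z gR gI ->
  texture_model A B0 (- lambda) P F (fun t w => - Wx t w) WR WI
    (fun t w => - Z t w) gR gI.
Proof.
move=> [hF [aWx aWR aWI start incr] aZ aR aI init sdeZ sdeR sdeI].
have rateE (f : R -> R) : (fun t w => f (texture_rate B0 (- lambda) (- Z t w))) =
    fun t w => f (texture_rate B0 lambda (Z t w)).
  by apply/funext => t; apply/funext => w; rewrite texture_rateN.
split.
- exact: hF.
- split => //; first exact: continuous_adaptedN.
    by apply: filterS start => w [-> -> ->]; rewrite oppr0.
  move=> s t s0 st.
  rewrite (_ : (fun w => - Wx t w - - Wx s w) = fun w => - (Wx t w - Wx s w)).
    apply: indep_centred_gaussiansN; last exact: incr.
    by rewrite sqrtr_eq0 -ltNge subr_gt0.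
  by apply/funext => w; rewrite opprB opprK addrC.
- exact: continuous_adaptedN.
- exact: aR.
- exact: aI.
- by apply: indep_centred_gaussiansN => //; exact: oner_neq0.
- move=> t t0; have [M [itoM eqn]] := sdeZ t t0; exists (fun w => - M w); split.
    exact: is_ito_integralN.
  apply: filterS eqn => w eqw.
  have intN : \int[lebesgue_measure]_(s in `[0, t]) (- A * - Z s w) =
      - \int[lebesgue_measure]_(s in `[0, t]) (- A * Z s w).
    rewrite -[RHS]mulN1r -RintegralZl//.
      by apply: eq_Rintegral => s _; rewrite mulrN mulN1r.
    apply: path_integrable => //.
    apply: (@pathM _ (cst (- A)) (fun s => Z s w)); last exact: aZ.2.
    by move=> x; exact: cvg_cst.
  by rewrite /= intN eqw !opprD.
- rewrite (_ : (fun t w => - (_ / 2) * gR t w) =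
    fun t w => - (texture_rate B0 lambda (Z t w) / 2) * gR t w).
    by rewrite (rateE (fun r => Num.sqrt (r / 2))).
  by apply/funext => t; apply/funext => w; rewrite texture_rateN.
- rewrite (_ : (fun t w => - (_ / 2) * gI t w) =
    fun t w => - (texture_rate B0 lambda (Z t w) / 2) * gI t w).
    by rewrite (rateE (fun r => Num.sqrt (r / 2))).
  by apply/funext => t; apply/funext => w; rewrite texture_rateN.
Qed.

Lemma observed_law_opp (A B0 Dt lambda : R) n (k : 'I_n -> nat)
    (Q : probability (n.-tuple (R * R)) R) :
  is_observed_law A B0 Dt lambda k Q -> is_observed_law A B0 Dt (- lambda) k Q.
Proof.
move=> [d [Om [P [F [Wx [WR [WI [Z [gR [gI [tm QE]]]]]]]]]]].
exists d, Om, P, F, (fun t w => - Wx t w), WR, WI, (fun t w => - Z t w), gR, gI.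
by split => //; exact: texture_model_opp.
Qed.

Lemma observed_law_even (A B0 Dt lambda : R) n (k : 'I_n -> nat)
    (Q Q' : probability (n.-tuple (R * R)) R) : 0 < A -> 0 < B0 -> 0 < Dt ->
  is_observed_law A B0 Dt lambda k Q -> is_observed_law A B0 Dt (- lambda) k Q' ->
  forall U, measurable U -> Q U = Q' U.
Proof.
by move=> A0 B00 Dt0 /observed_law_opp; exact: observed_law_unique.
Qed.

End sign_symmetry.

(** * Scores of even families and the Fisher metric *)

Section null_integrands.
Context d (T : measurableType d) (R : realType) (mu : {measure set T -> \bar R}).
Import HBNNSimple.

Lemma ge0_integral_ae0 (f : T -> \bar R) : (forall x, 0 <= f x)%E ->
  {ae mu, forall x, f x = 0%E} -> (\int[mu]_x f x = 0)%E.
Proof.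
move=> f0 fae; rewrite ge0_integralTE//; apply/eqP; rewrite eq_le; apply/andP; split.
  apply: ge_ereal_sup => _ [h /= hf <-].
  rewrite -integralT_nnsfun (ae_eq_integral (cst 0%E))//; first by rewrite integral0.
    by apply/measurable_EFinP.
  apply: filterS fae => x fx _; apply/eqP; rewrite eq_le; apply/andP; split.
    by rewrite /= -fx; exact: hf.
  by rewrite lee_fin.
apply: ereal_sup_ubound; exists (cst_nnsfun T 0%:nng) => //=.
exact: sintegral0.
Qed.

(** Meant for derivatives in a parameter, of which only the almost sure value is
    known: every simple function below [f] vanishes almost surely. *)
Lemma Rintegral_ae0 (f : T -> R) : {ae mu, forall x, f x = 0} ->
  \int[mu]_x f x = 0.
Proof.
move=> fae; rewrite /Rintegral integralE !ge0_integral_ae0 ?sube0//.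
- apply: filterS fae => x fx; rewrite funenegE/= fx oppr0 maxxx//.
- apply: filterS fae => x fx; rewrite funeposE/= fx maxxx//.
Qed.

End null_integrands.

Section densities.
Context d (T : measurableType d) (R : realType) (mu : {measure set T -> \bar R}).

Lemma density_unique (Q Q' : probability T R) f g : is_density mu Q f ->
  is_density mu Q' g -> (forall U, measurable U -> Q U = Q' U) ->
  {ae mu, forall y, f y = g y}.
Proof.
move=> [mf f0 Qf] [mg g0 Qg] QQ'.
have : ae_eq mu setT (EFin \o f) (EFin \o g).
  apply: integral_ae_eq => //.
  - apply/integrableP; split; first exact/measurable_EFinP.
    rewrite (eq_integral (EFin \o f)) => [|y _ /=]; last by rewrite ger0_norm.
    by rewrite -Qf// probability_setT ltry.
  - exact/measurable_EFinP.
  - by move=> U _ mU; rewrite -Qf// -Qg// QQ'.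
by apply: filterS => y /= /(_ I)[].
Qed.

Lemma density_ae (Q : probability T R) f (H : T -> Prop) : is_density mu Q f ->
  {ae mu, forall y, H y} -> {ae Q, forall y, H y}.
Proof.
move=> [mf f0 Qf] [N [mN N0 HN]]; exists N; split => //.
rewrite [LHS]Qf//; apply: null_set_integral => //.
by apply/measurable_EFinP; exact: measurable_funTS.
Qed.

Lemma density_gt0 (Q : probability T R) f : is_density mu Q f ->
  {ae Q, forall y, 0 < f y}.
Proof.
move=> [mf f0 Qf]; exists (f @^-1` [set 0]); split.
- by rewrite -[X in measurable X]setTI; exact: mf.
- rewrite [LHS]Qf.
    by apply: integral0_eq => y /= ->.
  by rewrite -[X in measurable X]setTI; exact: mf.
- move=> y /= /negP; rewrite -leNgt => fy; apply/eqP; rewrite eq_le fy/=.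
  exact: f0.
Qed.

End densities.

Section even_families.
Variable R : realType.

(** Evenness along one sequence tending to [0] already kills the derivative. *)
Lemma derive_even_along_seq (f : R -> R) : derivable f 0 1 ->
  (forall n : nat, f n.+1%:R^-1 = f (- n.+1%:R^-1)) -> 'D_1 f 0 = 0.
Proof.
move=> df feven.
have slope (u : nat -> R) : (forall n, u n != 0) -> u n @[n --> \oo] --> 0 ->
    (u n)^-1 * (f (u n) - f 0) @[n --> \oo] --> 'D_1 f 0.
  move=> u0 cu; have cuw : u n @[n --> \oo] --> (0 : R)^'.
    move=> B /cu; apply: (@filterS nat \oo _ (fun n => u n != 0 -> B (u n))) => n uB.
    by apply: uB; exact: u0.
  rewrite (_ : (fun n => _) = (fun h : R => h^-1 *: ((f \o shift 0) (h *: (1 : R)) - f 0))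
      \o u); first exact: cvg_comp cuw df.
  by apply/funext => n /=; rewrite scaler1 addr0.
have inv0 : n.+1%:R^-1 @[n --> \oo] --> (0 : R) by exact: cvg_harmonic.
have cvg_right := slope (fun n => n.+1%:R^-1) _ inv0.
have cvg_left := slope (fun n => - n.+1%:R^-1) _ _.
have D : 'D_1 f 0 = - 'D_1 f 0.
  apply: (@cvg_unique _ _ ((n.+1%:R^-1)^-1 * (f n.+1%:R^-1 - f 0) @[n --> \oo])) => //.
    by apply: cvg_right => n; rewrite invr_eq0 pnatr_eq0.
  rewrite (_ : (fun n => _) = fun n : nat =>
      - ((- n.+1%:R^-1)^-1 * (f (- n.+1%:R^-1) - f 0))); last first.
    by apply/funext => n; rewrite -feven invrN mulNr opprK.
  apply: cvgN; apply: cvg_left => [n|]; first by rewrite oppr_eq0 invr_eq0 pnatr_eq0.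
  by rewrite -[X in _ --> X]oppr0; exact: cvgN.
lra.
Qed.

(** Each density is determined up to a null set that depends on the parameter, so
    evenness can be imposed at countably many parameters at once only. *)
Lemma even_family_score d (T : measurableType d) (mu : {measure set T -> \bar R})
    (Q : R -> probability T R) (p : R -> T -> R) :
  (forall lambda, is_density mu (Q lambda) (p lambda)) ->
  (forall lambda U, measurable U -> Q lambda U = Q (- lambda) U) ->
  {ae Q 0, forall y, derivable (fun lambda => p lambda y) 0 1 ->
    is_derive (0 : R) 1 (fun lambda => ln (p lambda y)) 0}.
Proof.
move=> hp even.
have evenp : {ae Q 0, forall y, forall n : nat, p n.+1%:R^-1 y = p (- n.+1%:R^-1) y}.
  apply: ae_foralln => n; apply: density_ae (hp 0) _.
  exact: density_unique (hp _) (hp _) (even _).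
apply: filterS2 evenp (density_gt0 (hp 0)) => y evy py dy.
have D0 := derive_even_along_seq dy evy.
have dp : is_derive (0 : R) 1 (fun lambda => p lambda y) 0.
  by have := derivableP dy; rewrite D0.
have := is_derive1_comp (is_derive1_ln py) dp.
by rewrite mulr0.
Qed.

End even_families.

Section fisher.
Variable R : realType.

Lemma derive_line (V : normedModType R) (f : V -> R) (g : R -> R) a v (x : R) :
  (forall h : R, f (h *: v + a) = g (h *: (1 : R) + x)) ->
  'D_v f a = 'D_1 g x /\ (derivable f a v <-> derivable g x 1).
Proof.
move=> fg; have f0 : f a = g x by have := fg 0; rewrite !scale0r !add0r.
have E : (fun h : R => h^-1 *: ((f \o shift a) (h *: v) - f a)) =
    fun h => h^-1 *: ((g \o shift x) (h *: (1 : R)) - g x).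
  by apply/funext => h /=; rewrite f0 fg.
by rewrite /derive /derivable E.
Qed.

(** A score that vanishes almost surely gives a zero row. *)
Lemma fisher_mx_rank_lt d (T : measurableType d) m (Q : probability T R)
    (p : 'rV[R]_m -> T -> R) (theta : 'rV[R]_m) (j : 'I_m) :
  {ae Q, forall y, 'D_(delta_mx 0 j) (fun th => ln (p th y)) theta = 0} ->
  (\rank (fisher_mx Q p theta) < m)%N.
Proof.
move=> D0; rewrite ltn_neqAle rank_leq_row andbT; apply/negP => /row_freeP[B AB].
have rowj : row j (fisher_mx Q p theta) = 0.
  apply/rowP => i; rewrite !mxE; apply: Rintegral_ae0.
  by apply: filterS D0 => y ->; rewrite mul0r.
have : row j (fisher_mx Q p theta *m B) = 0 by rewrite row_mul rowj mul0mx.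
rewrite AB => /rowP/(_ j); rewrite !mxE eqxx => /eqP.
by rewrite oner_eq0.
Qed.

End fisher.

Theorem proposition2p1 (R : realType) (A Dt : R) (hA : 0 < A) (hDt : 0 < Dt)
    (n : nat) (k : 'I_n -> nat) :
  [/\ (* P_lambda = P_(-lambda) *)
      forall (B0 lambda : R) (Q Q' : probability (n.-tuple (R * R)) R),
        0 < B0 ->
        is_observed_law A B0 Dt lambda k Q ->
        is_observed_law A B0 Dt (- lambda) k Q' ->
        forall U, measurable U -> Q U = Q' U,
      (* the score in lambda vanishes at 0 *)
      forall (B0 : R) (P : R -> probability (n.-tuple (R * R)) R)
          (p : R -> n.-tuple (R * R) -> R),
        0 < B0 ->
        (forall lambda, is_observed_law A B0 Dt lambda k (P lambda)) ->
        (forall lambda, is_density (lebesgue_tuple R n) (P lambda) (p lambda)) ->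
        {ae P 0, forall y, derivable (fun lambda => p lambda y) (0 : R) 1 ->
          is_derive (0 : R) 1 (fun lambda => ln (p lambda y)) 0} /\
        (* and the Fisher metric in the coordinate lambda alone is singular at 0 *)
        ({ae P 0, forall y, derivable (fun lambda => p lambda y) (0 : R) 1} ->
         (\rank (fisher_mx (P 0) (fun theta : 'rV[R]_1 => p (theta 0 0)) 0)%R < 1)%N) &
      (* the Fisher metric in the coordinates (beta, lambda), with
         beta = log B0, is singular at every (beta, 0) *)
      forall (P : R -> R -> probability (n.-tuple (R * R)) R)
          (p : R -> R -> n.-tuple (R * R) -> R) (theta0 : 'rV[R]_2),
        (forall beta lambda,
          is_observed_law A (expR beta) Dt lambda k (P beta lambda)) ->
        (forall beta lambda,
          is_density (lebesgue_tuple R n) (P beta lambda) (p beta lambda)) ->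
        theta0 0 1 = 0 ->
        {ae P (theta0 0 0) 0, forall y i,
          derivable (fun theta : 'rV[R]_2 => p (theta 0 0) (theta 0 1) y)
            theta0 (delta_mx 0 i)} ->
        (\rank (fisher_mx (P (theta0 0 0) 0)
                  (fun theta : 'rV[R]_2 => p (theta 0 0) (theta 0 1)) theta0)%R
          < 2)%N].
Proof.
have score (B0 : R) (P : R -> probability (n.-tuple (R * R)) R)
    (p : R -> n.-tuple (R * R) -> R) : 0 < B0 ->
    (forall lambda, is_observed_law A B0 Dt lambda k (P lambda)) ->
    (forall lambda, is_density (lebesgue_tuple R n) (P lambda) (p lambda)) ->
    {ae P 0, forall y, derivable (fun lambda => p lambda y) (0 : R) 1 ->
      is_derive (0 : R) 1 (fun lambda => ln (p lambda y)) 0}.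
  move=> B00 lawP densP; apply: even_family_score densP _ => lambda U.
  exact: (observed_law_even hA B00 hDt (lawP lambda) (lawP (- lambda))).
split.
- by move=> B0 lambda Q Q' B00; exact: (observed_law_even hA B00 hDt).
- move=> B0 P p B00 lawP densP; have scoreP := score _ _ _ B00 lawP densP.
  split=> // der; apply: (@fisher_mx_rank_lt _ _ _ _ _ _ _ 0).
  apply: filterS2 scoreP der => y + dy => /(_ dy)[_ D0].
  have line (h : R) : (h *: delta_mx 0 0 + 0 : 'rV[R]_1) 0 0 = h *: (1 : R) + 0.
    by rewrite !mxE.
  have [-> _] := @derive_line _ _ (fun th : 'rV[R]_1 => ln (p (th 0 0) y))
    (fun lambda => ln (p lambda y)) 0 (delta_mx 0 0) 0
    (fun h => congr1 (fun l => ln (p l y)) (line h)).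
  exact: D0.
- move=> P p theta0 lawP densP theta00 der.
  have scoreP := score _ _ _ (expR_gt0 (theta0 0 0)) (lawP _) (densP _).
  apply: (@fisher_mx_rank_lt _ _ _ _ _ _ _ 1).
  apply: filterS2 scoreP der => y sc /(_ 1) dy.
  have line (h : R) : (h *: delta_mx 0 1 + theta0) 0 0 = theta0 0 0 /\
      (h *: delta_mx 0 1 + theta0) 0 1 = h *: (1 : R) + 0.
    by rewrite !mxE theta00 /= mulr0 add0r.
  have [_ [/(_ dy) dp _]] := @derive_line _ _
    (fun th : 'rV[R]_2 => p (th 0 0) (th 0 1) y) (p (theta0 0 0) ^~ y)
    theta0 (delta_mx 0 1) 0
    (fun h => let: conj e0 e1 := line h in
       f_equal2 (fun b l => p b l y) e0 e1).
  have [-> _] := @derive_line _ _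
    (fun th : 'rV[R]_2 => ln (p (th 0 0) (th 0 1) y))
    (fun lambda => ln (p (theta0 0 0) lambda y)) theta0 (delta_mx 0 1) 0
    (fun h => let: conj e0 e1 := line h in
       f_equal2 (fun b l => ln (p b l y)) e0 e1).
  by have [] := sc dp.
Qed.
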